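(* Let $G$ be a graph with $n$ vertices. Given an interval biclique partition of $G$ into $p$ bicliques, one can compute: (i) a DAG compression of $G$ of size $O(p\log n)$ in time $O(p\log n)$; and (ii) a positive tree model of $G$ with $O(p\log^2 n)$ transversal edges in time $O(p\log^2 n)$.
   Context: An interval biclique partition of $G$ is a linear order $<$ on $V(G)$ with a partition of $E(G)$ into bicliques $\{xy:x\in X,y\in Y\}$ with $X,Y$ disjoint intervals of $<$ (each given by its endpoints). A DAG compression $(D,B)$ of $G$ is a directed acyclic graph $D$ whose sinks are exactly $V(G)$ with a set $B$ of pairs of vertices of $D$ such that $uv\in E(G)$ iff some $xy\in B$ has directed paths $x\to u$ and $y\to v$ in $D$; its size is $|V(D)|+|E(D)|+|B|$. A positive tree model of $G$ is a full binary rooted tree $T$ whose leaves are $V(G)$, together with a set $B$ of pairwise non-crossing transversal edges (unordered pairs of distinct nodes, neither an ancestor of the other; $u_1v_1,u_2v_2$ cross if one of $u_1,v_1$ is a strict ancestor of one of $u_2,v_2$ and vice versa), such that two leaves $u,v$ are adjacent in $G$ iff some $u'v'\in B$ has $u'$ an ancestor of $u$ and $v'$ an ancestor of $v$ (ancestors possibly equal).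
   Formalization: The size and time in (i) are bounded by O(n + p log n) and the time in (ii) by O(n + p log² n), since outputs have at least n vertices (an edgeless graph has p = 0), so the bounds without n fail; n ≥ 1 is assumed; the O(p log² n) bound on transversal edges is unchanged. *)

(* Defs.v *)
From mathcomp Require Import all_boot.

Set Implicit Arguments.
Unset Strict Implicit.
Unset Printing Implicit Defensive.

Section Graphs.

Variable V : finType.
Implicit Types (G : rel V) (le : rel V).

Definition simple_graph G : Prop := symmetric G /\ irreflexive G.

Definition edges G : {set {set V}} :=
  [set [set uv.1; uv.2] | uv : V * V & G uv.1 uv.2].

Definition linear_order le : Prop :=
  [/\ reflexive le, antisymmetric le, transitive le & total le].

(* ((a, b), (c, d)) stands for the biclique between [a, b] and [c, d]. *)
Definition interval_pair := ((V * V) * (V * V))%type.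

Definition interval le (ab : V * V) : {set V} :=
  [set v | le ab.1 v && le v ab.2].

Definition biclique le (q : interval_pair) : {set {set V}} :=
  [set [set x; y] | x in interval le q.1, y in interval le q.2].

(* [uniq] makes [size qs] the number of parts of the partition. *)
Definition interval_biclique_partition G le (qs : seq interval_pair) : Prop :=
  [/\ linear_order le,
      forall q, q \in qs ->
        [/\ le q.1.1 q.1.2, le q.2.1 q.2.2
          & [disjoint interval le q.1 & interval le q.2]],
      uniq [seq biclique le q | q <- qs]
    & partition [set b in [seq biclique le q | q <- qs]] (edges G)].

Section DagCompression.

Variables (D : finType) (E : {set D * D}).

Definition arc : rel D := [rel x y | (x, y) \in E].

Definition acyclic : Prop := forall x y, arc x y -> ~~ connect arc y x.

Definition is_sink (x : D) : bool := [forall y, ~~ arc x y].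

(* [snk] identifies V(G) with the set of sinks. *)
Definition dag_compression G (snk : V -> D) (B : {set {set D}}) : Prop :=
  [/\ acyclic,
      injective snk /\ (forall x, is_sink x = (x \in codom snk)),
      forall e, e \in B -> #|e| = 2
    & forall u v, G u v <->
        exists x y, [/\ [set x; y] \in B,
                        connect arc x (snk u) & connect arc y (snk v)]].

Definition dag_size (B : {set {set D}}) : nat := #|D| + #|E| + #|B|.

(* Hence no bound O(p log n) on the size alone can hold when p log n = o(n), as
   for K_{n/2,n/2}, where p = 1: a term linear in n is unavoidable. *)
Lemma leq_dag_size G snk (B : {set {set D}}) :
  dag_compression G snk B -> #|V| <= dag_size B.
Proof.
case=> _ [inj_snk _] _ _; rewrite -(card_codom inj_snk) /dag_size -addnA.
exact: leq_trans (max_card _) (leq_addr _ _).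
Qed.

End DagCompression.

Section TreeModel.

(* The parent of a node; [None] for the root. *)
Variables (T : finType) (par : T -> option T).

Definition ancestor (x y : T) : bool := connect [rel u w | par u == Some w] y x.

Definition strict_ancestor (x y : T) : bool := (x != y) && ancestor x y.

Definition children (x : T) : {set T} := [set y | par y == Some x].

Definition is_leaf (x : T) : bool := #|children x| == 0.

(* A root above every node rules out cycles and further roots. *)
Definition full_binary_tree : Prop :=
  (exists r, par r = None /\ forall x, ancestor r x) /\
  (forall x, is_leaf x \/ #|children x| = 2).

Definition transversal (e : {set T}) : Prop :=
  #|e| = 2 /\ forall x y, x \in e -> y \in e -> ~~ strict_ancestor x y.

Definition crossing (e f : {set T}) : bool :=
  [exists x in e, exists y in f, strict_ancestor x y] &&
  [exists y in f, exists x in e, strict_ancestor y x].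

(* [leaf] identifies V(G) with the set of leaves. *)
Definition positive_tree_model G (leaf : V -> T) (B : {set {set T}}) : Prop :=
  [/\ full_binary_tree,
      injective leaf /\ (forall x, is_leaf x = (x \in codom leaf)),
      forall e, e \in B -> transversal e,
      forall e f, e \in B -> f \in B -> e != f -> ~~ crossing e f
    & forall u v, G u v <->
        exists x y, [/\ [set x; y] \in B,
                        ancestor x (leaf u) & ancestor y (leaf v)]].

End TreeModel.

End Graphs.

(* Structured programs for a word RAM: finitely many registers (those that the
   program mentions), random-access memory, and unit-cost instructions. *)

Inductive operand := Imm of nat | Reg of nat.

Inductive binop := OpAdd | OpSub | OpMul | OpDiv.

Inductive com :=
| Skip
| Op of nat & binop & operand & operand  (* r := a op b *)
| Read of nat & operand                  (* r := mem[a] *)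
| Write of operand & operand             (* mem[a] := b *)
| Seq of com & com
| If of operand & operand & com & com    (* if a < b then _ else _ *)
| While of operand & operand & com.      (* while a < b do _ *)

Record state := State { reg : nat -> nat; mem : nat -> nat }.

Definition upd (f : nat -> nat) (i v : nat) : nat -> nat :=
  fun j => if j == i then v else f j.

Definition oval (s : state) (a : operand) : nat :=
  match a with Imm k => k | Reg r => reg s r end.

(* Subtraction is truncated at 0 and division by 0 gives 0. *)
Definition bval (o : binop) (x y : nat) : nat :=
  match o with
  | OpAdd => x + y
  | OpSub => x - y
  | OpMul => x * y
  | OpDiv => x %/ y
  end.

(* [run W c s t s']: started in [s], the program [c] halts in [s'] after [t]
   steps. A word holds a number less than [W]; a program that computes or
   stores a larger number is stuck, so that it has no run. *)
Inductive run (W : nat) : com -> state -> nat -> state -> Prop :=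
| RunSkip s : run W Skip s 1 s
| RunOp r o a b s :
    bval o (oval s a) (oval s b) < W ->
    run W (Op r o a b) s 1
      (State (upd (reg s) r (bval o (oval s a) (oval s b))) (mem s))
| RunRead r a s :
    run W (Read r a) s 1 (State (upd (reg s) r (mem s (oval s a))) (mem s))
| RunWrite a b s :
    oval s a < W -> oval s b < W ->
    run W (Write a b) s 1 (State (reg s) (upd (mem s) (oval s a) (oval s b)))
| RunSeq c1 c2 s1 s2 s3 t1 t2 :
    run W c1 s1 t1 s2 -> run W c2 s2 t2 s3 ->
    run W (Seq c1 c2) s1 (t1 + t2) s3
| RunIfT a b c1 c2 s t s' :
    oval s a < oval s b -> run W c1 s t s' ->
    run W (If a b c1 c2) s t.+1 s'
| RunIfF a b c1 c2 s t s' :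
    ~~ (oval s a < oval s b) -> run W c2 s t s' ->
    run W (If a b c1 c2) s t.+1 s'
| RunWhileF a b c s :
    ~~ (oval s a < oval s b) -> run W (While a b c) s 1 s
| RunWhileT a b c s1 s2 s3 t1 t2 :
    oval s1 a < oval s1 b -> run W c s1 t1 s2 ->
    run W (While a b c) s2 t2 s3 ->
    run W (While a b c) s1 (t1 + t2).+1 s3.

(* Words of O(log (n + p)) bits. *)
Definition word_bound (k n p : nat) : nat := (n + p + 2) ^ k.

Definition initial_state (input : seq nat) : state :=
  State (fun _ => 0) (fun a => nth 0 input a).

(* The output starts at the address held by register 0. *)
Definition outputs (s : state) (out : seq nat) : Prop :=
  forall i, i < size out -> mem s (reg s 0 + i) = nth 0 out i.

Definition flatten_pairs (N : nat) (l : seq ('I_N * 'I_N)) : seq nat :=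
  flatten [seq [:: val e.1; val e.2] | e <- l].

Definition pairs_of (N : nat) (l : seq ('I_N * 'I_N)) : {set {set 'I_N}} :=
  [set [set e.1; e.2] | e in l].

(* n, p, the vertices in increasing order, the four endpoints of each biclique *)
Definition encode_ibp (n : nat) (le : rel 'I_n) (qs : seq (interval_pair 'I_n))
    : seq nat :=
  [:: n; size qs] ++ [seq val v | v <- sort le (enum 'I_n)] ++
  flatten [seq [:: val q.1.1; val q.1.2; val q.2.1; val q.2.2] | q <- qs].

(* |V(D)|, the lengths of both lists, the list of arcs, the list of pairs *)
Definition outputs_dag (s : state) (N : nat) (E : {set 'I_N * 'I_N})
    (B : {set {set 'I_N}}) : Prop :=
  exists es bs : seq ('I_N * 'I_N),
    [/\ E = [set e in es], B = pairs_of bs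
      & outputs s ([:: N; size es; size bs] ++
                   flatten_pairs es ++ flatten_pairs bs)].

(* |V(T)|, the length of the list, the parent of each node (N for the root),
   the list of transversal edges *)
Definition outputs_tree (s : state) (N : nat) (par : 'I_N -> option 'I_N)
    (B : {set {set 'I_N}}) : Prop :=
  exists bs : seq ('I_N * 'I_N),
    B = pairs_of bs /\
    outputs s ([:: N; size bs] ++
               [seq oapp val N (par x) | x <- enum 'I_N] ++ flatten_pairs bs).

(* Main.v *)
(**
Put the vertices in the given order at the leaves of a segment tree stored as
a heap: node [h] has the children [2h] and [2h + 1], and position [i] is the
leaf [n + i]. The bottom-up range query writes every interval as a disjoint
union of O(log n) maximal subtrees and needs no recursion.

For the DAG compression, each of the [2p] intervals gets a new node with arcs
to the roots of its subtrees, and each biclique becomes one pair of new nodes.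

For the tree model, each biclique becomes the O(log^2 n) pairs formed by a
subtree root of the one interval and one of the other. If two such pairs cross,
then leaves below the lower ends form an edge that lies in the bicliques of
both pairs; hence the two bicliques agree, which contradicts that the subtrees
of one interval are disjoint.
*)
Require Import Defs.
From mathcomp Require Import all_boot.
From mathcomp Require Import zify.

Set Implicit Arguments.
Unset Strict Implicit.
Unset Printing Implicit Defensive.

(* [mem] is shadowed by the membership predicate of ssrbool. *)
Local Notation ram := Defs.mem.

(** * Runs with a time budget *)

(** Unless [n] is a power of two, the leaves of the heap lie on two levels, and those below an
    arbitrary node need not be consecutive: for n = 5, node 2 has the leaves 8, 9 and 5. The method
    still works because a node chosen for an interval has its whole block of descendants on one
    level inside [n, 2n). That range does not span a factor of two, so no other level below the node
    meets it ([block_level]). Leaves keep the numbers of their vertices, which makes both embeddings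
    of V(G) equal to [widen_ord]; the inverse of the given order is tabulated once, so that an
    endpoint is located in constant time. A run has to meet its time budget and must never overflow
    a word. Every specification of a loop therefore bounds the length of the output as well as the
    time. The emitted lists are closed terms over natural numbers, and the models are verified from
    these terms without reference to the machine. *)

Definition setr r v s := State (upd (reg s) r v) (ram s).

(** Total correctness: the existential run excludes divergence and, since an overflowing instruction
    has no run, overflow as well. *)
Definition wp W (c : com) (t : nat) (Q : state -> Prop) (s : state) : Prop :=
  exists t' s', [/\ run W c s t' s', t' <= t & Q s'].

Fixpoint seqs (cs : seq com) : com :=
  if cs is c :: cs' then Seq c (seqs cs') else Skip.

Arguments seqs : simpl never.
Arguments setr : simpl never.

Section Wp.

Variable W : nat.
Implicit Types (c : com) (cs : seq com) (s : state) (Q : state -> Prop).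

Lemma wp_weaken c t t' Q Q' s :
  wp W c t Q s -> t <= t' -> (forall s', Q s' -> Q' s') -> wp W c t' Q' s.
Proof.
by case=> u [s' [r ut q]] tt' QQ'; exists u, s'; split; auto; apply: leq_trans tt'.
Qed.

Lemma wp_nil t Q s : 0 < t -> Q s -> wp W (seqs [::]) t Q s.
Proof. by move=> t0 q; exists 1, s; split=> //; apply: RunSkip. Qed.

Lemma wp_cons u c cs t Q s :
  wp W c u (wp W (seqs cs) (t - u) Q) s -> u <= t ->
  wp W (seqs (c :: cs)) t Q s.
Proof.
case=> t1 [s1 [r1 le1 [t2 [s2 [r2 le2 q]]]]] ut.
by exists (t1 + t2), s2; split=> //; [apply: RunSeq r1 r2 | lia].
Qed.

Lemma wp_op r o a b cs t Q s :
  bval o (oval s a) (oval s b) < W -> 0 < t ->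
  wp W (seqs cs) (t - 1)
    Q (setr r (bval o (oval s a) (oval s b)) s) ->
  wp W (seqs (Op r o a b :: cs)) t Q s.
Proof.
move=> lt t0 h; apply: (@wp_cons 1) => //.
by eexists 1, _; split; [apply: RunOp | |].
Qed.

Lemma wp_read r a cs t Q s :
  0 < t ->
  wp W (seqs cs) (t - 1) Q (setr r (ram s (oval s a)) s) ->
  wp W (seqs (Read r a :: cs)) t Q s.
Proof.
move=> t0 h; apply: (@wp_cons 1) => //.
by eexists 1, _; split; [apply: RunRead | |].
Qed.

Lemma wp_write a b cs t Q s :
  oval s a < W -> oval s b < W -> 0 < t ->
  wp W (seqs cs) (t - 1)
    Q (State (reg s) (upd (ram s) (oval s a) (oval s b))) ->
  wp W (seqs (Write a b :: cs)) t Q s.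
Proof.
move=> la lb t0 h; apply: (@wp_cons 1) => //.
by eexists 1, _; split; [apply: RunWrite | |].
Qed.

Lemma wp_if a b c1 c2 t Q s :
  0 < t ->
  (oval s a < oval s b -> wp W c1 (t - 1) Q s) ->
  (oval s b <= oval s a -> wp W c2 (t - 1) Q s) ->
  wp W (If a b c1 c2) t Q s.
Proof.
move=> t0 h1 h2; case: (ltnP (oval s a) (oval s b)) => ab.
  have [u [s' [r le q]]] := h1 ab.
  by exists u.+1, s'; split=> //; [apply: RunIfT | lia].
have [u [s' [r le q]]] := h2 ab.
by exists u.+1, s'; split=> //; [apply: RunIfF => //; rewrite -leqNgt | lia].
Qed.

(* [I f] holds when at most [f] iterations remain. *)
Lemma wp_while (I : nat -> state -> Prop) T f a b c Q s :
  (forall g s, I g s -> oval s a < oval s b ->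
     exists2 g', g = g'.+1 & wp W c T (I g') s) ->
  (forall g s, I g s -> oval s b <= oval s a -> Q s) ->
  I f s -> wp W (While a b c) (f * T.+1 + 1) Q s.
Proof.
move=> hT hF; elim: f s => [|f IH] s Is; case: (ltnP (oval s a) (oval s b)) => ab.
- by have [] := hT _ _ Is ab.
- by exists 1, s; split=> //; [apply: RunWhileF; rewrite -leqNgt | apply: hF Is ab].
- have [g [<-] [t1 [s1 [r1 le1 /IH[t2 [s2 [r2 le2 q]]]]]]] := hT _ _ Is ab.
  by exists (t1 + t2).+1, s2; split=> //; [apply: RunWhileT r1 r2 | lia].
- exists 1, s; split; [by apply: RunWhileF; rewrite -leqNgt | lia | exact: hF Is ab].
Qed.

End Wp.

(** * Programs *)

(* The roots of the maximal subtrees that make up the leaves [l, ..., r - 1],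
   where [f] is fuel: [r <= 2 ^ f] suffices. *)
Fixpoint qnodes (f l r : nat) : seq nat :=
  if f is f'.+1 then
    if l < r then
      (if l %/ 2 * 2 < l then [:: l] else [::]) ++
      (if r %/ 2 * 2 < r then [:: r %/ 2 * 2] else [::]) ++
      qnodes f' (l.+1 %/ 2) (r %/ 2)
    else [::]
  else [::].

(** Parity is tested by comparing [x] with [x / 2 * 2], as the machine has no remainder. The code
    [em] receives the reported node in [ru]. *)
Definition query (rl rr rm ru : nat) (em : com) : com :=
  While (Reg rl) (Reg rr) (seqs [::
    Op rm OpDiv (Reg rl) (Imm 2);
    Op rm OpMul (Reg rm) (Imm 2);
    If (Reg rm) (Reg rl) (seqs [:: Op ru OpAdd (Reg rl) (Imm 0); em]) Skip;
    Op rl OpAdd (Reg rl) (Imm 1);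
    Op rl OpDiv (Reg rl) (Imm 2);
    Op rm OpDiv (Reg rr) (Imm 2);
    Op rm OpMul (Reg rm) (Imm 2);
    If (Reg rm) (Reg rr) (seqs [:: Op ru OpAdd (Reg rm) (Imm 0); em]) Skip;
    Op rr OpDiv (Reg rr) (Imm 2)]).

Section Query.

Variables (W rl rr rm ru te F M : nat) (em : com).
Variable I : seq nat -> state -> Prop.
Hypothesis uniq_regs : uniq [:: rl; rr; rm; ru].
Hypothesis I_setr : forall out r v s,
  r \in [:: rl; rr; rm; ru] -> I out s -> I out (setr r v s).
Hypothesis em_spec : forall out j s,
  0 < j < M -> size out < 2 * F -> I out s -> reg s ru = j ->
  wp W em te (fun s' => [/\ I (rcons out j) s',
                           reg s' rl = reg s rl & reg s' rr = reg s rr]) s.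
Hypothesis MW : M.+1 < W.

(** The invariant [I] is abstract in the list of nodes reported so far, so that the lemma also
    applies to a query whose [em] runs another query. Each of the at most [F] rounds makes at most
    two reports and 20 further steps. *)
Lemma query_spec l r s :
  0 < l -> r <= M -> r <= 2 ^ F -> I [::] s -> reg s rl = l -> reg s rr = r ->
  wp W (query rl rr rm ru em) (F * (2 * te + 20).+1 + 1) (I (qnodes F l r)) s.
Proof.
move=> l0 rM rF Is el er.
move: uniq_regs; rewrite /= !inE !negb_or.
move=> /and4P[/and3P[/negbTE n1 /negbTE n2 /negbTE n3]].
move=> /andP[/negbTE n4 /negbTE n5] /negbTE n6 _.
have sy a b : (a == b :> nat) = false -> (b == a) = false by rewrite eq_sym.
have nE := (n1, n2, n3, n4, n5, n6, sy _ _ n1, sy _ _ n2, sy _ _ n3, sy _ _ n4,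
            sy _ _ n5, sy _ _ n6).
have regE : (forall a v s' b, reg (setr a v s') b = if b == a then v else reg s' b) *
            (forall f a v b, upd f a v b = if b == a then v else f b) by [].
have Il v out s' : I out s' -> I out (setr rl v s') by apply: I_setr; rewrite !inE eqxx.
have Ir v out s' : I out s' -> I out (setr rr v s') by apply: I_setr;
  rewrite !inE eqxx ?orbT.
have Im v out s' : I out s' -> I out (setr rm v s') by apply: I_setr;
  rewrite !inE eqxx ?orbT.
have Iu v out s' : I out s' -> I out (setr ru v s') by apply: I_setr;
  rewrite !inE eqxx ?orbT.
(* What has been reported, followed by the decomposition of the current range, never changes. The
   size clause counts two reports for each remaining round; it supplies the bound on [size out] that
   [em_spec] requires. *)
pose J g s' := exists out, [/\ I out s', 0 < reg s' rl, reg s' rr <= M,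
  reg s' rr <= 2 ^ g & size out + 2 * g <= 2 * F /\
  out ++ qnodes g (reg s' rl) (reg s' rr) = qnodes F l r].
apply: (@wp_while _ J); last first.
- exists [::]; rewrite el er; split=> //; split=> //; lia.
- move=> g s' [out [Io _ _ _ [_ <-]]] /= ge.
  by case: g => [|g] /=; rewrite ?cats0 // ltnNge ge /= cats0.
move=> g {s Is el er} s [out [Io l0' rM' rg [sz qE]]] /= lt.
case: g rg sz qE => [|g]; first by rewrite expn0; lia.
rewrite expnS /= lt => rg sz qE; exists g => //.
set x := reg s rl in l0' lt qE *; set y := reg s rr in rM' rg lt qE *.
apply: wp_op => /=; [rewrite -/x; lia | lia |].
apply: wp_op => /=; [rewrite ?(regE, eqxx) -/x; lia | lia |].
set o1 := if _ < _ then [:: x] else _ in qE.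
apply: (@wp_cons _ (te + 5)); last lia.
pose K1 s' := [/\ I (out ++ o1) s', reg s' rl = x & reg s' rr = y].
apply: (@wp_weaken _ _ (te + 5) _ K1) => //.
  apply: wp_if; first lia; rewrite /= ?(regE, nE, eqxx) /= -/x => h.
    apply: wp_op; rewrite /= ?(regE, nE, eqxx) /= -/x; [lia | lia |].
    apply: (@wp_cons _ te); last lia.
    apply: (wp_weaken (em_spec (out := out) (j := x) _ _ _ _)) => //; first lia;
      first lia.
    - by apply/Iu/Im/Im/Io.
    - by rewrite /= regE eqxx addn0.
    move=> s' [I' rE1 rE2]; apply: wp_nil; first lia.
    by split; rewrite ?rE1 ?rE2 ?(regE, nE, eqxx) /= // /o1 h cats1.
  eexists 1, _; split; [exact: RunSkip | lia |].
  split; rewrite ?(regE, nE, eqxx) /= // /o1 ltnNge h cats0.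
  by apply/Im/Im/Io.
move=> s1 [{}Io ex ey].
do 4 (apply: wp_op; rewrite /= ?(regE, nE, eqxx) /= ?ex ?ey; [lia | lia |]).
set o2 := if _ < _ then [:: _] else _ in qE.
apply: (@wp_cons _ (te + 5)); last lia.
pose K2 s' := [/\ I ((out ++ o1) ++ o2) s', reg s' rl = x.+1 %/ 2 & reg s' rr = y].
apply: (@wp_weaken _ _ (te + 5) _ K2) => //.
  apply: wp_if; first lia; rewrite /= ?(regE, nE, eqxx) /= ?ex ?ey => h.
    apply: wp_op; rewrite /= ?(regE, nE, eqxx) /= ?ex ?ey; [lia | lia |].
    apply: (@wp_cons _ te); last lia.
    have so1 : size o1 <= 1 by rewrite /o1; case: ifP.
    apply: (wp_weaken (em_spec (out := out ++ o1) (j := y %/ 2 * 2) _ _ _ _)) =>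
      //; first lia.
    - rewrite size_cat; lia.
    - by apply/Iu/Im/Im/Il/Il/Io.
    - by rewrite /= regE eqxx addn0.
    move=> s' [I' rE1 rE2]; apply: wp_nil; first lia.
    by split; rewrite ?rE1 ?rE2 ?(regE, nE, eqxx) /= ?ex ?ey ?addn1 // /o2 h cats1.
  eexists 1, _; split; [exact: RunSkip | lia |].
  split; rewrite ?(regE, nE, eqxx) /= ?ex ?ey ?addn1 // /o2 ltnNge h cats0.
  by apply/Im/Im/Il/Il/Io.
move=> s2 [{}Io {}ex {}ey].
apply: wp_op; rewrite /= ?(regE, nE, eqxx) /= ?ex ?ey; [lia | lia |].
apply: wp_nil; first lia.
exists (out ++ o1 ++ o2); rewrite ?(regE, nE, eqxx) /= ex; split; try lia.
- by apply: Ir; rewrite catA.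
- split; last by rewrite -!catA.
  by rewrite !size_cat /o1 /o2; do 2 case: ifP => _ /=; lia.
Qed.

End Query.

Lemma reg_setr a v s b : reg (setr a v s) b = if b == a then v else reg s b.
Proof. by []. Qed.

Lemma wp_time W t' c t Q s : wp W c t' Q s -> t' <= t -> wp W c t Q s.
Proof. by move=> h le; apply: wp_weaken h le _. Qed.

Lemma wp_call W u Q' c cs t Q s :
  wp W c u Q' s -> u <= t -> (forall s', Q' s' -> wp W (seqs cs) (t - u) Q s') ->
  wp W (seqs (c :: cs)) t Q s.
Proof. by move=> h ut k; apply: (@wp_cons _ u) => //; apply: wp_weaken h _ _. Qed.

(** * Building blocks of the two programs *)

Definition frame (rs : seq nat) (s s' : state) : Prop :=
  forall r, r \notin rs -> reg s' r = reg s r.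

(* Registers 0-5 are global: the address of the output, [n], [p], the address of
   the table of positions, the output pointer and [n - 1]. *)
Definition emit v := seqs [:: Write (Reg 4) v; Op 4 OpAdd (Reg 4) (Imm 1)].

Definition getid rd rs :=
  If (Reg rs) (Reg 1)
    (seqs [:: Op rd OpAdd (Reg rs) (Reg 5)])
    (seqs [:: Op rd OpSub (Reg rs) (Reg 1); Op rd OpAdd (Reg rd) (Imm 2);
              Read rd (Reg rd)]).

(* Register 10 points to the next interval endpoint of the input. *)
Definition load rd :=
  seqs [:: Read rd (Reg 10); Op rd OpAdd (Reg rd) (Reg 3); Read rd (Reg rd);
           Op rd OpAdd (Reg rd) (Reg 1); Op 10 OpAdd (Reg 10) (Imm 1)].

(** Inverts the order in linear time: the loop stores [i] in the table entry of the [i]-th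
    vertex. *)
Definition prelude hd :=
  seqs [:: Read 1 (Imm 0); Read 2 (Imm 1);
    Op 3 OpMul (Reg 2) (Imm 4); Op 3 OpAdd (Reg 3) (Reg 1); Op 3 OpAdd (Reg 3) (Imm 2);
    Op 0 OpAdd (Reg 3) (Reg 1); Op 4 OpAdd (Reg 0) (Imm hd); Op 5 OpSub (Reg 1) (Imm 1);
    Op 6 OpAdd (Imm 0) (Imm 0);
    While (Reg 6) (Reg 1) (seqs [::
      Op 7 OpAdd (Reg 6) (Imm 2); Read 7 (Reg 7); Op 7 OpAdd (Reg 7) (Reg 3);
      Write (Reg 7) (Reg 6); Op 6 OpAdd (Reg 6) (Imm 1)])].

Definition emit_pair ra rb := seqs [:: emit (Reg ra); emit (Reg rb)].

Definition flat (l : seq (nat * nat)) : seq nat :=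
  flatten [seq [:: e.1; e.2] | e <- l].

Lemma flat_cat l1 l2 : flat (l1 ++ l2) = flat l1 ++ flat l2.
Proof. by rewrite /flat map_cat flatten_cat. Qed.

Lemma size_flat l : size (flat l) = 2 * size l.
Proof. by elim: l => // e l IH; rewrite /flat /= -/(flat l) IH; lia. Qed.

Lemma iotaSr m k : iota m k.+1 = rcons (iota m k) (m + k).
Proof. by rewrite -addn1 iotaD cats1. Qed.

Lemma size_qnodes f l r : size (qnodes f l r) <= 2 * f.
Proof.
elim: f l r => //= f IH l r; case: ifP => // _; rewrite !size_cat.
by have := IH (l.+1 %/ 2) (r %/ 2); do 2 case: ifP => _ /=; lia.
Qed.

Definition interval_arcs :=
  While (Reg 6) (Reg 8) (seqs [:: load 11; load 12; Op 12 OpAdd (Reg 12) (Imm 1);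
    query 11 12 13 14 (seqs [:: getid 15 14; emit_pair 7 15]);
    Op 7 OpAdd (Reg 7) (Imm 1); Op 6 OpAdd (Reg 6) (Imm 1)]).

Definition heap_arcs :=
  While (Reg 6) (Reg 1) (seqs [:: Op 7 OpAdd (Reg 6) (Reg 5);
    Op 8 OpMul (Reg 6) (Imm 2); getid 9 8; emit_pair 7 9;
    Op 8 OpAdd (Reg 8) (Imm 1); getid 9 8; emit_pair 7 9;
    Op 6 OpAdd (Reg 6) (Imm 1)]).

Definition biclique_pairs :=
  While (Reg 6) (Reg 2) (seqs [:: Op 9 OpAdd (Reg 7) (Imm 1); emit_pair 7 9;
    Op 7 OpAdd (Reg 9) (Imm 1); Op 6 OpAdd (Reg 6) (Imm 1)]).

(** The three header cells are skipped and filled in last. The number of arcs is read off the output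
    pointer before the pairs are appended. *)
Definition dag_prog := seqs [:: prelude 3;
  Op 6 OpAdd (Imm 0) (Imm 1); heap_arcs;
  Op 6 OpAdd (Imm 0) (Imm 0); Op 7 OpAdd (Reg 1) (Reg 5);
  Op 8 OpMul (Reg 2) (Imm 2); Op 10 OpAdd (Reg 1) (Imm 2); interval_arcs;
  Op 8 OpSub (Reg 4) (Reg 0); Op 8 OpSub (Reg 8) (Imm 3); Op 8 OpDiv (Reg 8) (Imm 2);
  Op 6 OpAdd (Imm 0) (Imm 0); Op 7 OpAdd (Reg 1) (Reg 5); biclique_pairs;
  Write (Reg 0) (Reg 7); Op 9 OpAdd (Reg 0) (Imm 1); Write (Reg 9) (Reg 8);
  Op 9 OpAdd (Reg 9) (Imm 1); Write (Reg 9) (Reg 2)].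

Definition parent_list :=
  While (Reg 6) (Reg 7) (seqs [::
    If (Reg 6) (Reg 1)
      (seqs [:: Op 8 OpAdd (Reg 3) (Reg 6); Read 8 (Reg 8); Op 8 OpAdd (Reg 8) (Reg 1)])
      (seqs [:: Op 8 OpSub (Reg 6) (Reg 5)]);
    If (Reg 8) (Imm 2)
      (seqs [:: Op 9 OpAdd (Reg 7) (Imm 0)])
      (seqs [:: Op 9 OpDiv (Reg 8) (Imm 2); Op 9 OpAdd (Reg 9) (Reg 5)]);
    emit (Reg 9); Op 6 OpAdd (Reg 6) (Imm 1)]).

Definition inner_query :=
  query 18 19 20 21 (seqs [:: getid 22 21; emit_pair 15 22]).

(** A query destroys its bounds. Registers 16 and 17 thus preserve the second interval, which is
    copied to 18 and 19 for every node of the first one. *)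
Definition transversal_edges :=
  While (Reg 6) (Reg 2) (seqs [:: load 11; load 12; Op 12 OpAdd (Reg 12) (Imm 1);
    load 16; load 17; Op 17 OpAdd (Reg 17) (Imm 1);
    query 11 12 13 14 (seqs [:: getid 15 14; Op 18 OpAdd (Reg 16) (Imm 0);
      Op 19 OpAdd (Reg 17) (Imm 0); inner_query]);
    Op 6 OpAdd (Reg 6) (Imm 1)]).

Definition tree_prog := seqs [:: prelude 2;
  Op 6 OpAdd (Imm 0) (Imm 0); Op 7 OpAdd (Reg 1) (Reg 5); parent_list;
  Op 6 OpAdd (Imm 0) (Imm 0); Op 10 OpAdd (Reg 1) (Imm 2); transversal_edges;
  Op 7 OpAdd (Reg 1) (Reg 5); Write (Reg 0) (Reg 7);
  Op 8 OpSub (Reg 4) (Reg 0); Op 8 OpSub (Reg 8) (Imm 2); Op 8 OpSub (Reg 8) (Reg 7);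
  Op 8 OpDiv (Reg 8) (Imm 2);
  Op 9 OpAdd (Reg 0) (Imm 1); Write (Reg 9) (Reg 8)].

(** * Unordered pairs, reachability, and pairs of numbers as pairs of ordinals *)

Lemma set2_eq (T : finType) (x y a b : T) :
  [set x; y] = [set a; b] -> (x = a /\ y = b) \/ (x = b /\ y = a).
Proof.
move=> /setP e; move: (e x) (e y) (e a) (e b); rewrite !inE !eqxx ?orbT /=.
move=> /esym/orP xab /esym/orP yab /orP axy /orP bxy.
by case: xab yab axy bxy => /eqP ? [] /eqP ? [] /eqP ? [] /eqP ?; subst; auto.
Qed.

(** Used with a bound on a rank to prove acyclicity, and with arithmetic conditions on heap numbers
    to describe reachability. *)
Lemma connect_back (T : finType) (e : rel T) (P : T -> Prop) x y :
  (forall a b, e a b -> P b -> P a) -> connect e x y -> P y -> P x.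
Proof.
move=> eP /connectP[s]; elim: s x => [|z s IH] x /=; first by move=> _ ->.
by move=> /andP[xz pz] ey Py; apply: eP xz (IH _ pz ey Py).
Qed.

Section NatPairs.

Variable N : nat.

Definition npair (e : 'I_N * 'I_N) : nat * nat := (e.1 : nat, e.2 : nat).

Lemma npair_inj : injective npair.
Proof. by move=> [a b] [c d] [/val_inj-> /val_inj->]. Qed.

(** The programs emit numbers while the models live on ['I_N]; this provides the lists of ordinals
    behind an emitted list. *)
Lemma npair_lift (l : seq (nat * nat)) :
  (forall e, e \in l -> e.1 < N /\ e.2 < N) -> exists l', map npair l' = l.
Proof.
elim: l => [|[a b] l IH] h; first by exists [::].
have [|l' <-] := IH; first by move=> e el; apply: h; rewrite inE el orbT.
have [aN bN] := h (a, b) (mem_head _ _).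
by exists ((Ordinal aN, Ordinal bN) :: l').
Qed.

Lemma flatten_npair (l : seq ('I_N * 'I_N)) : flatten_pairs l = flat (map npair l).
Proof. by rewrite /flat -map_comp. Qed.

Lemma mem_npair l (x y : 'I_N) : ((x, y) \in l) = ((x : nat, y : nat) \in map npair l).
Proof. by rewrite -(mem_map npair_inj). Qed.

Lemma pairs_ofP l (x y : 'I_N) :
  reflect ((x : nat, y : nat) \in map npair l \/ (y : nat, x : nat) \in map npair l)
          ([set x; y] \in pairs_of l).
Proof.
rewrite -!mem_npair; apply: (iffP imsetP) => [[[a b] ab /set2_eq]|].
  by move=> [] [-> ->]; [left | right].
by case=> h; [exists (x, y) | exists (y, x)] => //; rewrite setUC.
Qed.

Lemma pairs_of_set2 (l : seq ('I_N * 'I_N)) (e : {set 'I_N}) :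
  e \in pairs_of l -> exists x y, e = [set x; y].
Proof. by case/imsetP=> -[a b] _ ->; exists a, b. Qed.

Lemma card_pairs_of (l : seq ('I_N * 'I_N)) : #|pairs_of l| <= size l.
Proof. exact: leq_trans (leq_imset_card _ _) (card_size _). Qed.

End NatPairs.

(** * Decomposition of an interval *)

Lemma divn2X x k : x %/ 2 ^ k.+1 = x %/ 2 %/ 2 ^ k.
Proof. by rewrite expnS divnMA. Qed.

Lemma divn_expP x k j : (x %/ 2 ^ k == j) = (j * 2 ^ k <= x < j.+1 * 2 ^ k).
Proof.
have k0 : 0 < 2 ^ k by rewrite expn_gt0.
by rewrite eqn_leq leq_divRL // -[_ <= j]ltnS ltn_divLR // andbC.
Qed.

(** A leaf that is not itself reported in this round has its parent in the halved range. Without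
    fuel the range is empty, since then [r <= 1 <= l]. *)
Lemma qnodes_cover f l r x :
  0 < l -> r <= 2 ^ f -> l <= x < r -> exists k, x %/ 2 ^ k \in qnodes f l r.
Proof.
elim: f l r x => [|f IH] l r x l0; first by rewrite expn0; lia.
rewrite expnS /= => rf xlr; rewrite ifT; last lia.
case: (boolP ((l %/ 2 * 2 < l) && (x == l))) => [/andP[h /eqP->]|h1].
  by exists 0; rewrite divn1 h mem_cat inE eqxx.
case: (boolP ((r %/ 2 * 2 < r) && (x == r %/ 2 * 2))) => [/andP[h /eqP->]|h2].
  by exists 0; rewrite divn1 h !mem_cat inE eqxx orbT.
have [|||k hk] := IH (l.+1 %/ 2) (r %/ 2) (x %/ 2); try lia.
by exists k.+1; rewrite divn2X !mem_cat hk !orbT.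
Qed.

(* The parity clauses say that the parent of [j] sticks out of [l, r). *)
Lemma qnodes_block f l r j :
  0 < l -> j \in qnodes f l r ->
  exists m, [/\ l <= j * 2 ^ m, j.+1 * 2 ^ m <= r,
    odd j -> j.-1 * 2 ^ m < l & ~~ odd j -> r < j.+2 * 2 ^ m].
Proof.
elim: f l r => //= f IH l r l0; case: ifP => // lr.
rewrite !mem_cat => /or3P[||/IH[|m [h1 h2 h3 h4]]].
- by case: ifP; rewrite ?inE // => h /eqP->; exists 0; rewrite expn0; split; lia.
- by case: ifP; rewrite ?inE // => h /eqP->; exists 0; rewrite expn0; split; lia.
- lia.
exists m.+1; rewrite expnS !(mulnCA _ 2).
split; [lia | lia | move=> /h3; lia | move=> /h4; lia].
Qed.

Section Leaves.

Variables (n l r f : nat).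
Hypothesis nl : n <= l.
Hypothesis rn : r <= 2 * n.
Hypothesis n0 : 0 < n.

Let l0 : 0 < l. Proof. exact: leq_trans nl. Qed.

(** A smaller [k] would put the descendants of [j] at distance [k] below [n], because doubling their
    upper end still gives at most [2 * n]; a larger [k] would put them at [2 * n] or beyond. *)
Lemma block_level j m x k :
  l <= j * 2 ^ m -> j.+1 * 2 ^ m <= r -> n <= x < 2 * n -> x %/ 2 ^ k = j -> k = m.
Proof.
move=> h1 h2 hx /eqP; rewrite divn_expP => /andP[h3 h4].
case: (ltngtP k m) => // km.
- have : 2 * 2 ^ k <= 2 ^ m by rewrite -expnS leq_exp2l.
  move=> h; have : j.+1 * (2 * 2 ^ k) <= j.+1 * 2 ^ m by rewrite leq_mul.
  by rewrite mulnCA; lia.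
- have : 2 * 2 ^ m <= 2 ^ k by rewrite -expnS leq_exp2l.
  move=> h; have : j * (2 * 2 ^ m) <= j * 2 ^ k by rewrite leq_mul.
  by rewrite mulnCA; lia.
Qed.

Lemma qnodes_leaf j x k :
  j \in qnodes f l r -> n <= x < 2 * n -> x %/ 2 ^ k = j -> l <= x < r.
Proof.
move=> /(qnodes_block l0)[m [h1 h2 _ _]] hx xk.
have e := block_level h1 h2 hx xk.
by move/eqP: xk; rewrite divn_expP e => /andP[]; lia.
Qed.

Lemma qnodes_has_leaf j :
  j \in qnodes f l r -> exists x k, l <= x < r /\ x %/ 2 ^ k = j.
Proof.
move=> /(qnodes_block l0)[m [h1 h2 _ _]].
have m0 : 0 < 2 ^ m by rewrite expn_gt0.
by exists (j * 2 ^ m), m; rewrite mulnK // h1; split=> //; lia.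
Qed.

Lemma qnodes_gt0 j : j \in qnodes f l r -> 0 < j < 2 * n.
Proof.
move=> /(qnodes_block l0)[m [h1 h2 _ _]].
have m0 : 0 < 2 ^ m by rewrite expn_gt0.
by case: j h1 h2 => [|j]; first lia; move=> _ h2; have := leq_pmulr j.+2 m0; lia.
Qed.

(** If [j1] were strictly above [j2], the block of the parent of [j2] would lie inside the block of
    [j1] and hence in [l, r), against the parity clauses of [qnodes_block]. *)
Lemma qnodes_antichain j1 j2 k :
  j1 \in qnodes f l r -> j2 \in qnodes f l r -> j2 %/ 2 ^ k = j1 -> j1 = j2.
Proof.
move=> /(qnodes_block l0)[m1 [a1 a2 _ _]].
move=> /(qnodes_block l0)[m2 [b1 b2 b3 b4]] kE.
have m0 : 0 < 2 ^ m2 by rewrite expn_gt0.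
have xk : (j2 * 2 ^ m2) %/ 2 ^ (m2 + k) = j1 by rewrite expnD divnMA mulnK.
have e := block_level a1 a2 _ xk.
case: k kE {xk} e => [|k] kE e; first by rewrite -kE divn1.
move/eqP: kE; rewrite divn2X divn_expP => /andP[c1 c2].
have {}e : m1 = k + m2.+1 by rewrite -e //; lia.
move: a1 a2; rewrite e expnD !mulnA => a1 a2.
have k0 : 0 < 2 ^ m2.+1 by rewrite expn_gt0.
have d1 : l <= j2 %/ 2 * 2 ^ m2.+1 by rewrite (leq_trans a1) // leq_mul.
have d2 : (j2 %/ 2).+1 * 2 ^ m2.+1 <= r by rewrite (leq_trans _ a2) // leq_mul.
rewrite !(expnS, mulnA) in d1 d2.
case: (boolP (odd j2)) => [o|o].
- move: (b3 o); rewrite (_ : j2 %/ 2 * 2 = j2.-1) in d1; lia.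
- move: (b4 o); rewrite (_ : (j2 %/ 2).+1 * 2 = j2.+2) in d2; lia.
Qed.

End Leaves.

(** * Identifiers of nodes and the lists to be output *)

Section Layout.

Variables (n p F : nat) (inp ordn posn : nat -> nat).

(* [hid] maps a heap node to its identifier, and [hidx] is the inverse. A leaf is
   identified by its vertex. *)
Definition hid h := if h < n then h + n.-1 else ordn (h - n).

Definition hidx x := if x < n then posn x + n else x - n.-1.

(** The value [2 * n - 1] is the number of nodes, by which the output format marks the root. *)
Definition parn x := if hidx x < 2 then 2 * n - 1 else hidx x %/ 2 + n.-1.

(* Interval [2 * i] and interval [2 * i + 1] are the sides of biclique [i];
   interval [i] consists of the heap leaves [lo i, ..., hi i - 1]. *)
Definition ep k := inp (n + 2 + k).
Definition lo i := posn (ep (2 * i)) + n.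
Definition hi i := posn (ep (2 * i).+1) + n + 1.
Definition nodes i := qnodes F (lo i) (hi i).

Definition tree_arcs k := flatten [seq [:: (j + n.-1, hid (2 * j));
  (j + n.-1, hid (2 * j).+1)] | j <- iota 1 k].

(** The identifiers below [2 * n - 1] are taken by the heap, so interval [i] is numbered
    [2 * n - 1 + i]. *)
Definition node_arcs i k := [seq (2 * n - 1 + i, hid j) | j <- k].

Definition int_arcs k := flatten [seq node_arcs i (nodes i) | i <- iota 0 k].

Definition bpairs k := [seq (2 * n - 1 + 2 * i, 2 * n + 2 * i) | i <- iota 0 k].

Definition dag_arcs := tree_arcs n.-1 ++ int_arcs (2 * p).

Definition dag_out :=
  [:: 2 * n - 1 + 2 * p; size dag_arcs; p] ++ flat dag_arcs ++ flat (bpairs p).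

Definition edge_block i ns :=
  flatten [seq [seq (hid j, hid j') | j' <- nodes (2 * i).+1] | j <- ns].

Definition tree_edges k :=
  flatten [seq edge_block i (nodes (2 * i)) | i <- iota 0 k].

Definition tree_out :=
  [:: 2 * n - 1; size (tree_edges p)] ++
  [seq parn x | x <- iota 0 (2 * n - 1)] ++ flat (tree_edges p).

Lemma size_tree_arcs k : size (tree_arcs k) = 2 * k.
Proof.
by elim: k => // k IH; rewrite /tree_arcs iotaSr map_rcons flatten_rcons size_cat
  IH /=; lia.
Qed.

Lemma int_arcsS k : int_arcs k.+1 = int_arcs k ++ node_arcs k (nodes k).
Proof. by rewrite /int_arcs iotaSr add0n map_rcons flatten_rcons. Qed.

Lemma size_int_arcs k : size (int_arcs k) <= 2 * F * k.
Proof.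
elim: k => // k IH; rewrite int_arcsS size_cat size_map.
by have := size_qnodes F (lo k) (hi k); rewrite /nodes; lia.
Qed.

Lemma tree_edgesS k :
  tree_edges k.+1 = tree_edges k ++ edge_block k (nodes (2 * k)).
Proof. by rewrite /tree_edges iotaSr add0n map_rcons flatten_rcons. Qed.

Lemma size_edge_block i ns : size (edge_block i ns) <= size ns * (2 * F).
Proof.
elim: ns => //= j ns IH; rewrite /edge_block /= size_cat size_map.
have := size_qnodes F (lo (2 * i).+1) (hi (2 * i).+1).
by rewrite -/(edge_block i ns) /nodes mulSn; lia.
Qed.

Lemma size_tree_edges k : size (tree_edges k) <= k * (2 * F * (2 * F)).
Proof.
elim: k => // k IH; rewrite tree_edgesS size_cat mulSn addnC leq_add //.
by rewrite (leq_trans (size_edge_block _ _)) // leq_mul // size_qnodes.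
Qed.

Hypothesis n0 : 0 < n.
Hypothesis ordn_lt : forall i, i < n -> ordn i < n.
Hypothesis posn_lt : forall x, x < n -> posn x < n.

Lemma hid_lt h : 0 < h < 2 * n -> hid h < 2 * n - 1.
Proof. by rewrite /hid; case: ifP => ? ?; have := @ordn_lt (h - n); lia. Qed.

Lemma hidx_lt x : x < 2 * n - 1 -> 0 < hidx x < 2 * n.
Proof. by rewrite /hidx; case: ifP => ? ?; have := @posn_lt x; lia. Qed.

Hypothesis inpE : forall i, i < 4 * p -> inp (n + 2 + i) < n.

Lemma lo_hi i : i < 2 * p -> n <= lo i < 2 * n /\ n < hi i <= 2 * n.
Proof.
move=> ip; have a : 2 * i < 4 * p by lia.
have b : (2 * i).+1 < 4 * p by lia.
by have := posn_lt (inpE a); have := posn_lt (inpE b); rewrite /lo /hi /ep; lia.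
Qed.

Hypothesis nF : 2 * n <= 2 ^ F.
Hypothesis ordnK : forall i, i < n -> posn (ordn i) = i.
Hypothesis posnK : forall x, x < n -> ordn (posn x) = x.

(** * Correctness of the programs *)

Section Machine.

Hypothesis inp0 : inp 0 = n.
Hypothesis inp1 : inp 1 = p.
Hypothesis inpO : forall i, i < n -> inp (i + 2) = ordn i.

Variables (W hd L : nat).

Definition pos_addr := 4 * p + n + 2.
Definition out_addr := pos_addr + n.
Definition body_addr := out_addr + hd.

Hypothesis hW : body_addr + 10 * n + 10 * p + L + 10 < W.

(** The memory holds, in this order, the input, the table of positions, [hd] header cells and the
    emitted words [out]. The header is left unspecified because it is written last. In [hW], [L]
    reserves space for the part of the output that grows with [F]. *)
Record st (out : seq nat) (s : state) : Prop := St {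
  st0 : reg s 0 = out_addr;
  st1 : reg s 1 = n;
  st2 : reg s 2 = p;
  st3 : reg s 3 = pos_addr;
  st4 : reg s 4 = body_addr + size out;
  st5 : reg s 5 = n.-1;
  st_inp : forall a, a < pos_addr -> ram s a = inp a;
  st_pos : forall x, x < n -> ram s (pos_addr + x) = posn x;
  st_out : forall i, i < size out -> ram s (body_addr + i) = nth 0 out i }.

Lemma st_setr r v out s : 5 < r -> st out s -> st out (setr r v s).
Proof. by case: r => [|[|[|[|[|[|r]]]]]] // _ [*]; split. Qed.

Lemma frame_setr r v rs s : r \in rs -> frame rs s (setr r v s).
Proof.
by move=> rin x xn; rewrite /setr /upd /=; case: eqP => // e; rewrite e rin in xn.
Qed.

Lemma frame_trans rs s1 s2 s3 : frame rs s1 s2 -> frame rs s2 s3 -> frame rs s1 s3.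
Proof. by move=> a b r rn; rewrite b // a. Qed.

Lemma emit_spec out s v x :
  st out s -> oval s v = x -> x < W -> size out < 10 * n + 10 * p + L ->
  wp W (emit v) 3 (fun s' => st (rcons out x) s' /\ frame [:: 4] s s') s.
Proof.
move=> S vx xW sz.
apply: wp_write => //=; rewrite ?vx ?(st4 S) //; first lia.
apply: wp_op => //=; rewrite ?(st4 S); first lia.
apply: wp_nil => //; split; last exact: frame_setr.
split=> //=; try by case: S.
- by rewrite /upd /= size_rcons; lia.
- move=> a aA; rewrite /upd ifF; first exact: st_inp S _ _.
  by apply/eqP; rewrite /body_addr /out_addr; lia.
- move=> a aA; rewrite /upd ifF; first exact: st_pos S _ _.
  by apply/eqP; rewrite /body_addr /out_addr; lia.
- move=> i; rewrite size_rcons nth_rcons /upd eqn_add2l => lt.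
  case: (ltngtP i (size out)) => h //; [exact: st_out S _ _ | lia].
Qed.

Lemma getid_spec out s rd rs h :
  st out s -> reg s rs = h -> 0 < h < 2 * n -> 5 < rd ->
  wp W (getid rd rs) 5
    (fun s' => [/\ st out s', reg s' rd = hid h & frame [:: rd] s s']) s.
Proof.
move=> S rh hn r5; apply: wp_if => //; rewrite /= rh (st1 S) => hh.
  apply: wp_op => //=; rewrite ?rh ?(st5 S); first lia.
  apply: wp_nil => //; split; first exact: st_setr.
    by rewrite /= /upd eqxx /hid hh.
  by apply: frame_setr; rewrite inE.
apply: wp_op => //=; rewrite ?rh ?(st1 S); first lia.
apply: wp_op => //=; rewrite /upd eqxx; first lia.
apply: wp_read => //=; rewrite /upd eqxx.
apply: wp_nil => //; split; first by do !apply: st_setr => //.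
  rewrite /= /upd eqxx (st_inp S); last by rewrite /pos_addr; lia.
  by rewrite inpO /hid 1?ltnNge ?hh //; lia.
by do !(apply: frame_trans; last by apply: frame_setr; rewrite inE).
Qed.

Lemma load_spec out s rd k :
  st out s -> reg s 10 = n + 2 + k -> k < 4 * p -> 10 < rd ->
  wp W (load rd) 6
    (fun s' => [/\ st out s', reg s' rd = posn (inp (n + 2 + k)) + n,
                   reg s' 10 = n + 2 + k.+1 & frame [:: rd; 10] s s']) s.
Proof.
move=> S e kp r10.
have kn := inpE kp; have pk := posn_lt kn.
have rE : (rd == 10) = false by lia.
have rE' : (10 == rd) = false by lia.
have r3 : (3 == rd) = false by lia.
have r1 : (1 == rd) = false by lia.
have AE : pos_addr = 4 * p + n + 2 by [].
have GE : body_addr = pos_addr + n + hd by [].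
apply: wp_read => //=; rewrite e (st_inp S); last lia.
apply: wp_op => //=; rewrite /upd ?eqxx r3 (st3 S); first lia.
apply: wp_read => //=; rewrite /upd ?eqxx [_ + pos_addr]addnC (st_pos S) //.
apply: wp_op => //=; rewrite /upd ?eqxx r1 ?(st1 S); first lia.
apply: wp_op => //=; rewrite /upd rE' e; first lia.
apply: wp_nil => //; split; first by do !apply: st_setr => //; lia.
- by rewrite /= /upd rE eqxx.
- by rewrite /= /upd /=; lia.
- by do !(apply: frame_trans; last by apply: frame_setr; rewrite !inE eqxx ?orbT).
Qed.

Lemma prelude_spec s :
  (forall a, ram s a = inp a) ->
  wp W (prelude hd) (7 * n + 20) (st [::]) s.
Proof.
move=> sE.
have AE : pos_addr = 4 * p + n + 2 by [].
have HE : out_addr = pos_addr + n by [].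
have GE : body_addr = out_addr + hd by [].
apply: wp_read => /=; rewrite ?sE ?inp0; first lia.
apply: wp_read => /=; rewrite ?sE ?inp1; first lia.
do 7 (apply: wp_op; rewrite /= /upd /=; [lia | lia |]).
pose J g s' := [/\ g <= n, reg s' 6 = n - g,
  [/\ reg s' 0 = out_addr, reg s' 1 = n, reg s' 2 = p, reg s' 3 = pos_addr & reg s'
    4 = body_addr],
  reg s' 5 = n.-1 & [/\ forall a, a < pos_addr -> ram s' a = inp a &
  forall i, i < n - g -> ram s' (pos_addr + ordn i) = i]].
apply: (@wp_call _ (n * 7 + 1) (st [::])); [|lia|by move=> *; apply: wp_nil; first lia].
apply: (@wp_while _ J).
- move=> g s' [gn r6 [r0 r1 r2 r3 r4] r5 [mi mo]] /=; rewrite r6 r1 => lt.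
  case: g gn r6 mo lt => [|g] gn r6 mo lt; first lia.
  exists g => //.
  have i_n : n - g.+1 < n by lia.
  have oi := ordn_lt i_n.
  apply: wp_op => //=; rewrite ?r6; first lia.
  apply: wp_read => //=; rewrite /upd /= mi; last lia.
  rewrite inpO //.
  apply: wp_op => //=; rewrite /upd /= r3; first lia.
  apply: wp_write => //=; rewrite /upd /= ?r6; [lia | lia |].
  apply: wp_op => //=; rewrite /upd /= ?r6; first lia.
  apply: wp_nil => //; split=> //=; rewrite /upd /=; try lia.
  split=> [a aA|i lt']; first by rewrite ifF ?mi //; lia.
  have [->|ne] := eqVneq i (n - g.+1); first by rewrite addnC eqxx.
  (* [posn] undoes [ordn], so distinct positions carry distinct vertices and the new entry
     overwrites no earlier one. *)
  rewrite ifF; first by apply: mo; lia.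
  apply/negP=> /eqP e; move/eqP: ne; apply.
  by rewrite -(@ordnK i) -1?[n - g.+1](ordnK i_n); [congr posn|]; lia.
- move=> g s' [gn r6 [r0 r1 r2 r3 r4] r5 [mi mo]] /=; rewrite r6 r1 => lt.
  split=> //=; first by rewrite addn0.
  move=> x xn; rewrite -[in LHS](posnK xn); apply: mo.
  by have := posn_lt xn; lia.
split; rewrite /= /upd /=; try lia; split; try lia; first by move=> a _; exact: sE.
Qed.

Lemma emit_pair_spec out s ra rb :
  st out s -> reg s ra < W -> reg s rb < W -> rb != 4 ->
  (size out).+1 < 10 * n + 10 * p + L ->
  wp W (emit_pair ra rb) 7
    (fun s' => st (out ++ [:: reg s ra; reg s rb]) s' /\ frame [:: 4] s s') s.
Proof.
move=> S aW bW b4 sz.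
apply: (wp_call (emit_spec (v := Reg ra) S erefl aW _)) => //; first lia.
move=> s1 [S1 f1].
apply: (wp_call (emit_spec (v := Reg rb) S1 erefl _ _)) => //=.
- by rewrite f1 // inE.
- by rewrite size_rcons; lia.
move=> s2 [S2 f2]; apply: wp_nil => //; split; last exact: frame_trans f1 f2.
by move: S2; rewrite /= -!cats1 -catA f1 // inE.
Qed.

Lemma heap_arcs_spec s :
  st [::] s -> reg s 6 = 1 ->
  wp W heap_arcs (n * 40 + 1) (st (flat (tree_arcs n.-1))) s.
Proof.
move=> S e6.
pose J g s' := [/\ g < n, reg s' 6 = n - g & st (flat (tree_arcs (n.-1 - g))) s'].
apply: (@wp_weaken _ _ (n.-1 * 40 + 1) _ (st (flat (tree_arcs n.-1)))) => //; last lia.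
apply: (@wp_while _ J).
- move=> {e6}g {S}s [gn e6 S] /=; rewrite e6 (st1 S) => lt.
  case: g gn e6 S lt => [|g] gn e6 S lt; first lia.
  exists g => //.
  have hj := @hid_lt (2 * (n - g.+1)).
  have hj1 := @hid_lt (2 * (n - g.+1)).+1.
  have sz := size_tree_arcs (n.-1 - g.+1).
  apply: wp_op => //=; rewrite ?e6 ?(st5 S); first lia.
  apply: wp_op => //=; rewrite /upd /= ?e6; first lia.
  set s1 := setr 8 _ _.
  have S1 : st (flat (tree_arcs (n.-1 - g.+1))) s1 by do !apply: st_setr => //.
  apply: (wp_call (getid_spec (rs := 8) (h := 2 * (n - g.+1)) (rd := 9) S1 _ _ _))
    => //.
  + by rewrite /= /upd /=; lia.
  + lia.
  move=> s2 [S2 e29 f2].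
  apply: (wp_call (emit_pair_spec (ra := 7) (rb := 9) S2 _ _ _ _)) => //.
  + by rewrite f2 //= /upd /=; lia.
  + by rewrite e29; lia.
  + by rewrite size_flat; lia.
  move=> s3 [S3 f3].
  apply: wp_op; rewrite //= f3 // f2 //= /upd /=; first lia.
  set s4 := setr 8 _ _.
  have S4 := st_setr (r := 8) ((n - g.+1) * 2 + 1) isT S3.
  apply: (wp_call (getid_spec (rs := 8) (h := (2 * (n - g.+1)).+1) (rd := 9) S4 _ _
    _)) => //.
  + by rewrite /= /upd /=; lia.
  + lia.
  move=> s5 [S5 e59 f5].
  apply: (wp_call (emit_pair_spec (ra := 7) (rb := 9) S5 _ _ _ _)) => //.
  + by rewrite f5 //= /upd /= f3 // f2 //= /upd /=; lia.
  + by rewrite e59; lia.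
  + by rewrite size_cat /= size_flat; lia.
  move=> s6 [S6 f6].
  apply: wp_op => //=; rewrite f6 // f5 //= /upd /= f3 // f2 //= /upd /= e6; first lia.
  apply: wp_nil => //; split=> //=; try lia.
  + rewrite /upd /=; lia.
  apply: st_setr => //; move: S6.
  rewrite e59 f5 //= e29 /upd /= f3 // f2 //= /upd /=.
  rewrite (_ : n.-1 - g = (n.-1 - g.+1).+1); last lia.
  rewrite /tree_arcs iotaSr map_rcons flatten_rcons flat_cat -catA /= /flat /=.
  by rewrite (_ : n - g.+1 = 1 + (n.-1 - g.+1)) //; lia.
- move=> g s' [gn r6 S'] /=; rewrite r6 (st1 S') => lt.
  by rewrite (_ : n.-1 = n.-1 - g) //; lia.
by split; rewrite ?subnn ?e6 //; lia.
Qed.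

(** The bound [8 * (p * F)] counts words: [2 * p] intervals, at most [2 * F] arcs for each, two
    words per arc. A report is budgeted at 14 steps, and [49 = 2 * 14 + 20 + 1]. *)
Lemma interval_arcs_spec s base :
  8 * (p * F) <= L -> size base <= 2 * n ->
  st (flat base) s -> reg s 6 = 0 -> reg s 7 = 2 * n - 1 -> reg s 8 = 2 * p ->
  reg s 10 = n + 2 ->
  wp W interval_arcs ((2 * p) * (F * 49 + 30).+1 + 1)
    (st (flat (base ++ int_arcs (2 * p)))) s.
Proof.
move=> pFL szb S e6 e7 e8 e10.
pose J g s' := [/\ g <= 2 * p, reg s' 6 = 2 * p - g, reg s' 7 = 2 * n - 1 + (2 * p - g),
  reg s' 8 = 2 * p /\ reg s' 10 = n + 2 + 2 * (2 * p - g) &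
  st (flat (base ++ int_arcs (2 * p - g))) s'].
have AE : pos_addr = 4 * p + n + 2 by [].
have GE : body_addr = pos_addr + n + hd by [].
apply: (@wp_while _ J).
- move=> {S e6 e7 e8 e10}g {}s [gp e6 e7 [e8 e10] S] /=; rewrite e6 e8 => lt.
  case: g gp e6 e7 e10 S lt => [|g] gp e6 e7 e10 S lt; first lia.
  exists g => //; set i := 2 * p - g.+1 in e6 e7 e10 S lt *.
  have [lo_i hi_i] := lo_hi lt.
  have szi := size_int_arcs i.
  have szF : 2 * F * i + 2 * F <= 4 * (p * F).
    by have : F * i.+1 <= F * (2 * p); [rewrite leq_mul2l lt orbT | lia].
  apply: (wp_call (load_spec (rd := 11) S e10 _ _)) => //; [lia | lia |].
  move=> s1 [S1 e1 e1' f1].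
  apply: (wp_call (load_spec (rd := 12) S1 e1' _ _)) => //; [lia | lia |].
  move=> s2 [S2 e2 e2' f2].
  have e2i : reg s2 12 + 1 = hi i by rewrite e2.
  apply: wp_op; rewrite /= ?e2i; [lia | lia |].
  pose I out s' := [/\ st (flat (base ++ int_arcs i) ++ flat (node_arcs i out)) s',
    reg s' 6 = i, reg s' 7 = 2 * n - 1 + i, reg s' 8 = 2 * p
    & reg s' 10 = n + 2 + 2 * i.+1].
  apply: (@wp_call _ (F * 49 + 1) (I (nodes i))); last 1 first.
  + move=> s3 [S3 e36 e37 e38 e3x].
    apply: wp_op; rewrite /= ?e37; [lia | lia |].
    apply: wp_op; rewrite /= ?e36 /upd /= ?e36; [lia | lia |].
    apply: wp_nil; first lia.
    split; rewrite /= /upd /= ?e36 ?e38 ?e3x; try lia.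
    do 2 apply: st_setr => //.
    rewrite (_ : 2 * p - g = i.+1); last lia.
    by rewrite int_arcsS catA flat_cat.
  + apply: (wp_weaken (@query_spec W 11 12 13 14 14 F (2 * n) _ I
      _ _ _ _ (lo i) (hi i) _ _ _ _ _ _ _)) => //; try lia.
    * move=> out r v s'; rewrite !inE => hr [S' a b c d].
      have r10 : 10 < r by case/or4P: hr => /eqP->.
      split; try by rewrite reg_setr ifF //; apply/eqP; lia.
      by apply: st_setr => //; lia.
    * move=> out j s' jn szo [S' a b c d] ej.
      have hj := hid_lt jn.
      apply: (wp_call (getid_spec (rd := 15) S' ej jn _)) => //.
      move=> s3 [S3 e3 f3].
      apply: (wp_call (emit_pair_spec (ra := 7) (rb := 15) S3 _ _ _ _)) => //.
      - by rewrite f3 // b; lia.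
      - by rewrite e3; lia.
      - rewrite size_cat !size_flat size_cat size_map; lia.
      move=> s4 [S4 f4]; apply: wp_nil => //; split; try by rewrite f4 // f3.
      split; try by rewrite f4 // f3.
      move: S4; rewrite f3 // b e3 -cats1 /node_arcs map_cat !flat_cat.
      by rewrite -!catA.
    * by split; rewrite /= /upd /= ?cats0 ?e2' ?f2 ?f1 //; [exact: st_setr | lia].
    * by rewrite /= /upd /= f2 // e1.
  + lia.
- move=> g s' [gp r6 r7 [r8 _] S'] /=; rewrite r6 r8 => lt.
  by rewrite (_ : 2 * p = 2 * p - g) //; lia.
by split; rewrite ?subnn ?cats0 //; lia.
Qed.

(** Besides the output, the header needs two registers afterwards: register 7 ends as the number of
    nodes, and register 8 still holds the number of arcs. *)
Lemma biclique_pairs_spec s out :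
  size out <= 2 * n * 4 + L ->
  st out s -> reg s 6 = 0 -> reg s 7 = 2 * n - 1 ->
  wp W biclique_pairs (p * 20 + 1)
    (fun s' => [/\ st (out ++ flat (bpairs p)) s', reg s' 7 = 2 * n - 1 + 2 * p
                 & reg s' 8 = reg s 8]) s.
Proof.
move=> sz S e6 e7.
pose J g s' := [/\ g <= p, reg s' 6 = p - g, reg s' 7 = 2 * n - 1 + 2 * (p - g),
  reg s' 8 = reg s 8 & st (out ++ flat (bpairs (p - g))) s'].
have AE : pos_addr = 4 * p + n + 2 by [].
have GE : body_addr = pos_addr + n + hd by [].
apply: (@wp_while _ J).
- move=> g s1 [gp a6 a7 a8 S1] /=; rewrite a6 (st2 S1) => lt.
  case: g gp a6 a7 S1 lt => [|g] gp a6 a7 S1 lt; first lia.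
  exists g => //; set i := p - g.+1 in a6 a7 S1 lt *.
  apply: wp_op; rewrite /= ?a7; [lia | lia |].
  have S2 := st_setr (r := 9) (2 * n - 1 + 2 * i + 1) isT S1.
  apply: (wp_call (emit_pair_spec (ra := 7) (rb := 9) S2 _ _ _ _)) => //.
  + by rewrite /= /upd /= a7; lia.
  + by rewrite /= /upd /=; lia.
  + by rewrite size_cat size_flat size_map size_iota; lia.
  move=> s3 [S3 f3].
  apply: wp_op; rewrite //= ?f3 //= /upd /=; first lia.
  apply: wp_op; rewrite //= /upd /= f3 //= /upd /= ?a6; first lia.
  apply: wp_nil => //; split; rewrite /= /upd /= ?f3 //=; try lia.
  do 2 apply: st_setr => //.
  rewrite (_ : p - g = i.+1); last lia.
  move: S3; rewrite /= /upd /= a7 /bpairs iotaSr map_rcons -cats1 flat_cat catA add0n.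
  by rewrite [flat [:: _]]/flat /= (_ : 2 * n - 1 + 2 * i + 1 = 2 * n + 2 * i) //; lia.
- move=> g s' [gp r6 r7 r8 S'] /=; rewrite r6 (st2 S') => lt.
  have pg : p - g = p by lia.
  by move: S' r7; rewrite pg => S' r7; split.
by split; rewrite ?subnn ?cats0 //; lia.
Qed.

Lemma dag_prog_spec s :
  hd = 3 -> 8 * (p * F) <= L -> (forall a, ram s a = inp a) ->
  wp W dag_prog (7 * n + 20 + (n * 40 + 1) + ((2 * p) * (F * 49 + 30).+1 + 1) +
                 (p * 20 + 1) + 20) (fun s' => outputs s' dag_out) s.
Proof.
move=> hd3 pFL sE.
have AE : pos_addr = 4 * p + n + 2 by [].
have GE : body_addr = pos_addr + n + hd by [].
have HE : out_addr = pos_addr + n by [].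
have sa := size_tree_arcs n.-1; have si := size_int_arcs (2 * p).
rewrite /dag_prog -[X in prelude X]hd3.
apply: (wp_call (prelude_spec sE)) => [|s1 S1]; first lia.
(* Naming the nonlinear terms leaves a linear budget. *)
set T1 := n * 40 + 1; set T2 := 2 * p * _ + 1; set T3 := p * 20 + 1.
apply: (@wp_time _ (1 + T1 + T2 + T3 + 19)); last lia.
apply: wp_op; rewrite /=; [lia | lia |].
apply: (wp_call (heap_arcs_spec (st_setr _ _ S1) _)) => //; first lia.
move=> s2 S2.
apply: (@wp_time _ (T2 + T3 + 19)); last lia.
do 4 (apply: wp_op; rewrite /= /upd /= ?(st1 S2) ?(st2 S2) ?(st5 S2); [lia | lia |]).
apply: (wp_call (interval_arcs_spec (base := tree_arcs n.-1) pFL _ _ _ _ _ _)) => //;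
  rewrite /= /upd /=; try lia.
  by do 4 apply: st_setr => //.
move=> s3 S3; rewrite -/dag_arcs in S3.
apply: (@wp_time _ (T3 + 15)); last lia.
have sd : size dag_arcs <= 2 * n + 2 * F * (2 * p) by rewrite size_cat; lia.
have sdL : 2 * F * (2 * p) * 2 <= L by lia.
have r4 := st4 S3; rewrite size_flat in r4.
do 5 (apply: wp_op; rewrite /= /upd /= ?(st1 S3) ?(st0 S3) ?(st5 S3) ?r4;
  [lia | lia |]).
apply: (wp_call (biclique_pairs_spec (out := flat dag_arcs) _ _ _ _));
  rewrite /= /upd /=; try lia.
- by rewrite size_flat; lia.
- by do 5 apply: st_setr => //.
move=> s4 [S4 e7].
rewrite (_ : (_ - _ - 3) %/ 2 = size dag_arcs); last first.
  by rewrite HE GE hd3; lia.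
move=> e8; apply: (@wp_time _ 10); last lia.
apply: wp_write; rewrite /= ?(st0 S4) ?e7; [lia | lia | lia |].
apply: wp_op; rewrite /= ?(st0 S4); [lia | lia |].
apply: wp_write; rewrite /= /upd /= ?e8; [lia | lia | lia |].
apply: wp_op; rewrite /= /upd /=; [lia | lia |].
apply: wp_write; rewrite /= /upd /= ?(st2 S4); [lia | lia | lia |].
apply: wp_nil; first lia.
rewrite /outputs /= /upd /= (st0 S4).
case=> [|[|[|i]]] /= lt.
- by do 3 (case: eqP => ?; first lia); lia.
- by do 3 (case: eqP => ?; first lia); lia.
- by do 3 (case: eqP => ?; first lia); lia.
do 3 (case: eqP => [?|_]; first lia).
rewrite -(st_out S4) //; congr (ram _ _); lia.
Qed.

Lemma parent_list_spec s :
  st [::] s -> reg s 6 = 0 -> reg s 7 = 2 * n - 1 ->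
  wp W parent_list (n * 42 + 1) (st [seq parn x | x <- iota 0 (2 * n - 1)]) s.
Proof.
move=> S e6 e7.
have AE : pos_addr = 4 * p + n + 2 by [].
have GE : body_addr = pos_addr + n + hd by [].
pose J g s' := [/\ g <= 2 * n - 1, reg s' 6 = 2 * n - 1 - g, reg s' 7 = 2 * n - 1
  & st [seq parn x | x <- iota 0 (2 * n - 1 - g)] s'].
apply: (@wp_time _ ((2 * n - 1) * 21 + 1)); last lia.
apply: (@wp_while _ J).
- move=> {S e6 e7}g {}s [gn e6 e7 S] /=; rewrite e6 e7 => lt.
  case: g gn e6 S lt => [|g] gn e6 S lt; first lia.
  exists g => //; set x := 2 * n - 1 - g.+1 in e6 S lt *.
  have hx := hidx_lt lt.
  set out := map _ _ in S.
  pose Q s' := [/\ st out s', reg s' 8 = hidx x & frame [:: 8] s s'].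
  apply: (@wp_call _ 6 Q) => //.
    apply: wp_if => //; rewrite /= e6 (st1 S) => xn.
      have px := posn_lt xn.
      apply: wp_op => //=; rewrite ?(st3 S) ?e6; first lia.
      apply: wp_read => //=; rewrite /upd /= (st_pos S) //.
      apply: wp_op => //=; rewrite /upd /= (st1 S); first lia.
      apply: wp_nil => //; split; first by do !apply: st_setr => //.
        by rewrite /= /upd /= /hidx xn.
      by do !(apply: frame_trans; last exact: frame_setr).
    apply: wp_op => //=; rewrite ?(st5 S) ?e6; first lia.
    apply: wp_nil => //; split; first exact: st_setr.
      by rewrite /= /upd /= /hidx ltnNge xn.
    exact: frame_setr.
  move=> s1 [S1 e1 f1].
  pose Q' s' := [/\ st out s', reg s' 9 = parn x & frame [:: 9] s1 s'].
  apply: (@wp_call _ 4 Q') => //.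
    apply: wp_if => //; rewrite /= e1 => h2.
      apply: wp_op => //=; rewrite ?f1 ?e7 //; first lia.
      apply: wp_nil => //; split; first exact: st_setr.
        by rewrite /= /upd /= /parn h2 addn0.
      exact: frame_setr.
    apply: wp_op => //=; rewrite ?e1 ?(st5 S1); first lia.
    apply: wp_op => //=; rewrite /upd /= (st5 S1); first lia.
    apply: wp_nil => //; split; first by do !apply: st_setr => //.
      by rewrite /= /upd /= /parn ltnNge h2.
    by do !(apply: frame_trans; last exact: frame_setr).
  move=> s2 [S2 e2 f2].
  have parn_lt : parn x < W by rewrite /parn; case: ifP; lia.
  apply: (wp_call (emit_spec (v := Reg 9) S2 e2 parn_lt _)) => //.
    by rewrite /out size_map size_iota; lia.
  move=> s3 [S3 f3].
  apply: wp_op => //=; rewrite f3 // f2 // f1 // e6; first lia.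
  apply: wp_nil => //; split; rewrite /= /upd /= ?f3 ?f2 ?f1 //; try lia.
  apply: st_setr => //; rewrite (_ : 2 * n - 1 - g = x.+1); last lia.
  by rewrite iotaSr map_rcons.
- move=> g s' [gn r6 r7 S'] /=; rewrite r6 r7 => lt.
  by rewrite (_ : 2 * n - 1 - g = 2 * n - 1) in S' => //; lia.
by split; rewrite ?subnn //; lia.
Qed.

(** A report of the outer query is an entire inner query, budgeted at [F * 49 + 20] steps; this is
    the source of the second logarithmic factor. The output needs two words for each of at most
    [(2 * F) ^ 2] pairs per biclique. *)
Lemma transversal_edges_spec s base :
  p * (2 * F * (2 * F)) * 2 <= L -> size base <= 2 * n ->
  st base s -> reg s 6 = 0 -> reg s 10 = n + 2 ->
  wp W transversal_edges
    (p * (F * (2 * (F * 49 + 20) + 20).+1 + 50).+1 + 1)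
    (st (base ++ flat (tree_edges p))) s.
Proof.
move=> pFL szb S e6 e10.
pose J g s' := [/\ g <= p, reg s' 6 = p - g, reg s' 10 = n + 2 + 4 * (p - g)
  & st (base ++ flat (tree_edges (p - g))) s'].
have AE : pos_addr = 4 * p + n + 2 by [].
have GE : body_addr = pos_addr + n + hd by [].
apply: (@wp_while _ J).
- move=> {S e6 e10}g {}s [gp e6 e10 S] /=; rewrite e6 (st2 S) => lt.
  case: g gp e6 e10 S lt => [|g] gp e6 e10 S lt; first lia.
  exists g => //; set i := p - g.+1 in e6 e10 S lt *.
  have lt0 : 2 * i < 2 * p by lia.
  have lt1 : (2 * i).+1 < 2 * p by lia.
  have [lo0 hi0] := lo_hi lt0; have [lo1 hi1] := lo_hi lt1.
  have szi := size_tree_edges i.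
  have szF : i.+1 * (2 * F * (2 * F)) <= p * (2 * F * (2 * F)) by rewrite leq_mul.
  rewrite mulSn in szF.
  move: szi szF pFL; set FF := 2 * F * (2 * F) => szi szF pFL.
  have k4 : 4 * i = 2 * (2 * i) by lia.
  rewrite k4 in e10.
  apply: (wp_call (load_spec (rd := 11) S e10 _ _)) => //; [lia | lia |].
  move=> s1 [S1 e1 e1' f1].
  apply: (wp_call (load_spec (rd := 12) S1 e1' _ _)) => //; [lia | lia |].
  move=> s2 [S2 e2 e2' f2].
  have e2i : reg s2 12 + 1 = hi (2 * i) by rewrite e2.
  apply: wp_op; rewrite /= ?e2i; [lia | lia |].
  have e2'' : reg (setr 12 (hi (2 * i)) s2) 10 = n + 2 + 2 * (2 * i).+1.
    by rewrite /= /upd /= e2'; lia.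
  apply: (wp_call (load_spec (rd := 16) (st_setr _ _ S2) e2'' _ _)) => //;
    [lia | lia |].
  move=> s3 [S3 e3 e3' f3].
  apply: (wp_call (load_spec (rd := 17) S3 e3' _ _)) => //; [lia | lia |].
  move=> s4 [S4 e4 e4' f4].
  have e4i : reg s4 17 + 1 = hi (2 * i).+1 by rewrite e4.
  apply: wp_op; rewrite /= ?e4i; [lia | lia |].
  set T := F * _.+1.
  apply: (@wp_time _ (T + 5)); last lia.
  pose out0 := base ++ flat (tree_edges i).
  pose I out s' := [/\ st (out0 ++ flat (edge_block i out)) s',
    reg s' 6 = i, reg s' 16 = lo (2 * i).+1, reg s' 17 = hi (2 * i).+1
    & reg s' 10 = n + 2 + 4 * i.+1].
  apply: (@wp_call _ (T + 1) (I (nodes (2 * i)))); last 1 first.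
  + move=> s5 [S5 e56 _ _ e5x].
    apply: wp_op; rewrite /= ?e56; [lia | lia |].
    apply: wp_nil; first lia.
    split; rewrite /= /upd /= ?e5x; try lia.
    apply: st_setr => //.
    rewrite (_ : p - g = i.+1); last lia.
    by rewrite tree_edgesS flat_cat catA.
  + apply: (wp_weaken (@query_spec W 11 12 13 14 (F * 49 + 20) F (2 * n) _ I
      _ _ _ _ (lo (2 * i)) (hi (2 * i)) _ _ _ _ _ _ _)) => //; try lia.
    * move=> out r v s'; rewrite !inE => hr [S' a b c d].
      have r10 : 10 < r < 15 by case/or4P: hr => /eqP->.
      split; try by rewrite reg_setr ifF //; apply/eqP; lia.
      by apply: st_setr => //; lia.
    * move=> out j s' jn szo [S' a b c d] ej.
      (* As fewer than [2 * F] outer nodes have been treated, one more row of [2 * F] pairs fits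
         within [FF]. *)
      have szo' : size out * (2 * F) + 2 * F <= FF.
        by rewrite addnC -mulSn leq_mul.
      have hj := hid_lt jn; have szb' := size_edge_block i out.
      apply: (wp_call (getid_spec (rd := 15) S' ej jn _)) => //; first lia.
      move=> s5 [S5 e5 f5].
      apply: wp_op; rewrite /= ?f5 // ?b; [lia | lia |].
      apply: wp_op; rewrite /= /upd /= ?f5 // ?c; [lia | lia |].
      pose out1 := out0 ++ flat (edge_block i out).
      (* The inner query has to preserve registers 11 and 12, which hold the remaining range of the
         outer one. *)
      pose I' ou s'' := [/\ st (out1 ++ flat [seq (hid j, hid j') | j' <- ou]) s'',
        reg s'' 15 = hid j, [/\ reg s'' 6 = i, reg s'' 16 = lo (2 * i).+1,
         reg s'' 17 = hi (2 * i).+1 & reg s'' 10 = n + 2 + 4 * i.+1],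
        reg s'' 11 = reg s' 11 & reg s'' 12 = reg s' 12].
      apply: (@wp_call _ (F * 49 + 1) (I' (nodes (2 * i).+1))); last 1 first.
      - move=> s6 [S6 e65 [e66 e616 e617 e610] e611 e612].
        apply: wp_nil; first lia.
        split=> //; split=> //.
        move: S6; rewrite -cats1 /edge_block map_cat flatten_cat flat_cat /= cats0.
        by rewrite /out1 -catA.
      - apply: (wp_weaken (@query_spec W 18 19 20 21 14 F (2 * n) _ I'
          _ _ _ _ (lo (2 * i).+1) (hi (2 * i).+1) _ _ _ _ _ _ _)) => //; try lia.
        + move=> ou r v s''; rewrite !inE => hr [S'' a1 [a2 a3 a4 a5] a6 a7].
          have r10 : 17 < r by case/or4P: hr => /eqP->.
          split; [|rewrite reg_setr ifF //; apply/eqP; lia|split| |];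
            try by rewrite reg_setr ifF //; apply/eqP; lia.
          by apply: st_setr => //; lia.
        + move=> ou j' s'' jn' szo'' [S'' a1 [a2 a3 a4 a5] a6 a7] ej'.
          have hj' := hid_lt jn'.
          apply: (wp_call (getid_spec (rd := 22) S'' ej' jn' _)) => //.
          move=> s6 [S6 e66 f6].
          apply: (wp_call (emit_pair_spec (ra := 15) (rb := 22) S6 _ _ _ _)) => //.
          * by rewrite f6 // a1; lia.
          * by rewrite e66; lia.
          * rewrite /out1 /out0 !size_cat !size_flat size_map; lia.
          move=> s7 [S7 f7]; apply: wp_nil => //; split; try by rewrite f7 // f6.
          split; [|by rewrite f7 // f6|split| |]; try by rewrite f7 // f6.
          move: S7; rewrite f6 // a1 e66 -cats1 map_cat flat_cat.
          by rewrite -!catA.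
        + split; [|by rewrite /= /upd /=|split| |]; rewrite /= /upd /= ?f5 //.
          by rewrite cats0; do 2 apply: st_setr => //.
        + by rewrite /= /upd /= addn0.
        + by rewrite /= /upd /= addn0.
      - lia.
    * split; rewrite /= /upd /= ?cats0 ?e4' ?f4 ?e3 ?f3 /= /upd /= ?f2 ?f1 //; try lia.
      by apply: st_setr.
    * by rewrite /= /upd /= f4 // f3 //= /upd /= f2 // e1.
    * by rewrite /= /upd /= f4 // f3 //= /upd /=.
  + lia.
- move=> g s' [gp r6 _ S'] /=; rewrite r6 (st2 S') => lt.
  by rewrite (_ : p - g = p) in S' => //; lia.
by split; rewrite ?subnn ?cats0 //; lia.
Qed.

Lemma tree_prog_spec s :
  hd = 2 -> p * (2 * F * (2 * F)) * 2 <= L -> (forall a, ram s a = inp a) ->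
  wp W tree_prog (7 * n + 20 + (n * 42 + 1) +
    (p * (F * (2 * (F * 49 + 20) + 20).+1 + 50).+1 + 1) + 20)
    (fun s' => outputs s' tree_out) s.
Proof.
move=> hd2 pFL sE.
have AE : pos_addr = 4 * p + n + 2 by [].
have GE : body_addr = pos_addr + n + hd by [].
have HE : out_addr = pos_addr + n by [].
have se := size_tree_edges p.
rewrite /tree_prog -[X in prelude X]hd2.
apply: (wp_call (prelude_spec sE)) => [|s1 S1]; first lia.
set T1 := n * 42 + 1; set T2 := p * _ + 1.
apply: (@wp_time _ (T1 + T2 + 20)); last lia.
do 2 (apply: wp_op; rewrite /= /upd /= ?(st1 S1) ?(st5 S1); [lia | lia |]).
apply: (wp_call (parent_list_spec _ _ _)); rewrite /= /upd /=; try lia.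
  by do 2 apply: st_setr => //.
move=> s2 S2.
apply: (@wp_time _ (T2 + 18)); last lia.
do 2 (apply: wp_op; rewrite /= /upd /= ?(st1 S2); [lia | lia |]).
apply: (wp_call (transversal_edges_spec
  (base := [seq parn x | x <- iota 0 (2 * n - 1)]) pFL _ _ _ _)) => //;
  rewrite /= /upd /=; try lia.
- by rewrite size_map size_iota; lia.
- by do 2 apply: st_setr => //.
move=> s3 S3.
apply: (@wp_time _ 15); last lia.
have r4 := st4 S3; rewrite size_cat size_flat size_map size_iota in r4.
apply: wp_op; rewrite /= ?(st1 S3) ?(st5 S3); [lia | lia |].
apply: wp_write; rewrite /= /upd /= ?(st0 S3); [lia | lia | lia |].
do 4 (apply: wp_op; rewrite /= /upd /= ?(st0 S3) ?r4; [lia | lia |]).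
rewrite (_ : (_ - _ - 2 - _) %/ 2 = size (tree_edges p)); last first.
  by rewrite HE GE hd2; lia.
apply: wp_op; rewrite /= /upd /= ?(st0 S3); [lia | lia |].
apply: wp_write; rewrite /= /upd /=; [lia | lia | lia |].
apply: wp_nil; first lia.
rewrite /outputs /= /upd /= (st0 S3).
case=> [|[|i]] /= lt.
- by do 2 (case: eqP => ?; first lia); lia.
- by do 2 (case: eqP => ?; first lia); lia.
do 2 (case: eqP => [?|_]; first lia).
rewrite -(st_out S3) //; congr (ram _ _); lia.
Qed.

End Machine.

(** * Correctness of the models *)

Variable G : rel 'I_n.

Definition in_int i (v : 'I_n) := lo i <= hidx v < hi i.

Hypothesis lt_lo_hi : forall i, i < 2 * p -> lo i < hi i.
(** The boolean [c] tells which side contains [u]; this covers both orientations of a biclique at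
    once. *)
Hypothesis adjE : forall u v, G u v <-> exists i (c : bool),
  [/\ i < p, in_int (2 * i + c) u & in_int (2 * i + ~~ c) v].
Hypothesis sides_disjoint : forall i (c : bool) v, i < p ->
  in_int (2 * i + c) v -> in_int (2 * i + ~~ c) v -> False.
Hypothesis bicliques_disjoint : forall i j (c d : bool) u v, i < p -> j < p ->
  in_int (2 * i + c) u -> in_int (2 * i + ~~ c) v ->
  in_int (2 * j + d) u -> in_int (2 * j + ~~ d) v -> i = j.

Lemma hidK h : 0 < h < 2 * n -> hidx (hid h) = h.
Proof.
rewrite /hid /hidx => hn; case: (ltnP h n) => hh; first by rewrite ifF; lia.
by rewrite ordn_lt ?ordnK; lia.
Qed.

Lemma hidxK x : x < 2 * n - 1 -> hid (hidx x) = x.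
Proof.
rewrite /hid /hidx => hn; case: (ltnP x n) => hh; last by rewrite ifT; lia.
by rewrite ifF ?addnK ?posnK //; lia.
Qed.

Lemma hidx_inj x y : x < 2 * n - 1 -> y < 2 * n - 1 -> hidx x = hidx y -> x = y.
Proof. by move=> xn yn e; rewrite -(hidxK xn) e hidxK. Qed.

Lemma hidx_leaf (v : 'I_n) : n <= hidx v < 2 * n.
Proof. by rewrite /hidx ltn_ord; have := posn_lt (ltn_ord v); lia. Qed.

Lemma leq_hidx x : x < 2 * n - 1 -> (n <= hidx x) = (x < n).
Proof. by rewrite /hidx; case: ifP; lia. Qed.

Lemma hidx_leaf_exists h : n <= h < 2 * n -> exists v : 'I_n, hidx v = h.
Proof.
move=> hn; have lt : ordn (h - n) < n by apply: ordn_lt; lia.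
by exists (Ordinal lt); rewrite /hidx /= lt ordnK; lia.
Qed.

Lemma bounds i : i < 2 * p -> n <= lo i /\ hi i <= 2 * n.
Proof. by move=> ip; have [] := lo_hi ip; lia. Qed.

Lemma nodes_gt0 i j : i < 2 * p -> j \in nodes i -> 0 < j < 2 * n.
Proof. by move=> /bounds[a b]; apply: qnodes_gt0. Qed.

Lemma nodes_cover i (v : 'I_n) : i < 2 * p -> in_int i v ->
  exists k, hidx v %/ 2 ^ k \in nodes i.
Proof. by move=> /bounds[a b]; apply: qnodes_cover; lia. Qed.

Lemma nodes_leaf i j k (v : 'I_n) : i < 2 * p -> j \in nodes i -> hidx v %/ 2 ^ k = j ->
  in_int i v.
Proof.
by move=> /bounds[a b] jn e; apply: qnodes_leaf a b n0 _ _ _ jn (hidx_leaf v) e.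
Qed.

Lemma nodes_has_leaf i j : i < 2 * p -> j \in nodes i ->
  exists (v : 'I_n) k, in_int i v /\ hidx v %/ 2 ^ k = j.
Proof.
move=> ip; have [a b] := bounds ip.
move=> /(qnodes_has_leaf a b n0)[x [k [xi e]]].
have [|v ev] := @hidx_leaf_exists x; first lia.
by exists v, k; rewrite /in_int ev.
Qed.

(** * The DAG compression *)

Section Dag.

Local Notation N := (2 * n - 1 + 2 * p).

Lemma mem_tree_arcs a b :
  (a, b) \in tree_arcs n.-1 <->
  [/\ a < 2 * n - 1, b < 2 * n - 1, 1 < hidx b & hidx b %/ 2 = hidx a].
Proof.
split=> [/flatten_mapP[h]|[an bn b1 e]].
  rewrite mem_iota !inE => hn; have l0 : 0 < 2 * h < 2 * n by lia.
  have l1 : 0 < (2 * h).+1 < 2 * n by lia.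
  have ea : hidx (h + n.-1) = h by rewrite /hidx ifF; lia.
  by case/orP=> /eqP[-> ->]; rewrite ea hidK //; split=> //; try lia; apply: hid_lt.
have b2 := hidx_lt bn.
apply/flatten_mapP; exists (hidx a); first by rewrite mem_iota -e; lia.
have -> : hidx a + n.-1 = a by rewrite -[RHS](hidxK an) /hid ifT // -e; lia.
rewrite -{1}(hidxK bn) !inE; apply/orP.
case: (boolP (odd (hidx b))) => o; [right | left]; apply/eqP; congr (_, hid _); lia.
Qed.

Lemma mem_int_arcs a b k :
  (a, b) \in int_arcs k <->
  exists i j, [/\ i < k, a = 2 * n - 1 + i, j \in nodes i & b = hid j].
Proof.
split=> [/flatten_mapP[i]|[i [j [ik -> jn ->]]]].
  by rewrite mem_iota => ik /mapP[j jn [-> ->]]; exists i, j.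
apply/flatten_mapP; exists i; first by rewrite mem_iota.
by apply/mapP; exists j.
Qed.

Lemma dag_arcs_lt e : e \in dag_arcs -> e.1 < N /\ e.2 < N.
Proof.
case: e => a b; rewrite mem_cat => /orP[/mem_tree_arcs[]|/mem_int_arcs]; first
  by rewrite /=; lia.
move=> [i [j [ip -> jn ->]]] /=.
by have := hid_lt (nodes_gt0 ip jn); lia.
Qed.

Lemma bpairs_lt e : e \in bpairs p -> e.1 < N /\ e.2 < N.
Proof. by case/mapP=> i; rewrite mem_iota => ip -> /=; lia. Qed.

Variables (es bs : seq ('I_N * 'I_N)) (leN : n <= N).
Hypothesis esE : map (@npair N) es = dag_arcs.
Hypothesis bsE : map (@npair N) bs = bpairs p.

Local Notation E := [set e in es].
Local Notation snk := (widen_ord leN).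

Lemma arcE (x y : 'I_N) : Defs.arc E x y = ((x : nat, y : nat) \in dag_arcs).
Proof. by rewrite /Defs.arc /= inE mem_npair esE. Qed.

(** Every arc raises this rank: children have larger heap numbers than their parents, and no arc
    enters an interval node. *)
Definition dag_rank x := if x < 2 * n - 1 then hidx x else 0.

Lemma dag_rank_lt (x y : 'I_N) : Defs.arc E x y -> dag_rank x < dag_rank y.
Proof.
rewrite arcE mem_cat /dag_rank => /orP[/mem_tree_arcs[-> -> b1 <-]|]; first lia.
move=> /mem_int_arcs[i [j [ip -> jn ->]]].
have j0 := nodes_gt0 ip jn.
by rewrite hid_lt // hidK // ifF; lia.
Qed.

Definition dag_leaf (x : nat) (v : 'I_n) : Prop :=
  if x < 2 * n - 1 then exists k, hidx v %/ 2 ^ k = hidx x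
  else in_int (x - (2 * n - 1)) v.

(** Forwards, the condition is carried back along the path; at an interval node it holds because
    leaves below a chosen node belong to the interval. Backwards, an interval node has an arc to a
    chosen node above [v], from which the path descends in the heap. *)
Lemma dag_reach (x : 'I_N) v : connect (Defs.arc E) x (snk v) <-> dag_leaf x v.
Proof.
have vn := ltn_ord v.
split=> [c|].
  apply: (connect_back (P := fun z : 'I_N => dag_leaf z v) _ c) => [a b|]; last first.
    by rewrite /dag_leaf /= ifT; [exists 0; rewrite divn1 | lia].
  rewrite arcE mem_cat /dag_leaf => /orP[/mem_tree_arcs[-> -> b1 <-]|].
    by case=> k <-; exists k.+1; rewrite expnSr divnMA.
  move=> /mem_int_arcs[i [j [ip -> jn ->]]].
  rewrite hid_lt ?(nodes_gt0 ip jn) // hidK ?(nodes_gt0 ip jn) //.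
  by case=> k e; rewrite ifF ?addKn; [apply: nodes_leaf jn e | lia].
have tree (z : 'I_N) : z < 2 * n - 1 ->
    (exists k, hidx v %/ 2 ^ k = hidx z) -> connect (Defs.arc E) z (snk v).
  move=> zn [k]; elim: k z zn => [|k IH] z zn e.
    suff -> : z = snk v by exact: connect0.
    by apply/val_inj/hidx_inj => //=; [lia | rewrite -e divn1].
  (* The child of [z] on the way to [v] has heap number [hidx v %/ 2 ^ k]. *)
  rewrite expnSr divnMA in e.
  have z0 := hidx_lt zn.
  have h0 : 0 < hidx v %/ 2 ^ k < 2 * n.
    by have := hidx_leaf v; have := leq_div (hidx v) (2 ^ k); lia.
  have yn := hid_lt h0.
  have yN : hid (hidx v %/ 2 ^ k) < N by lia.
  apply: (@connect_trans _ _ (Ordinal yN)); last by apply: IH => //=; rewrite hidK.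
  apply: connect1; rewrite arcE mem_cat; apply/orP; left; apply/mem_tree_arcs.
  by rewrite /= hidK //; split=> //; lia.
rewrite /dag_leaf; case: ifP => [|xn xi]; first exact: tree.
have ip : x - (2 * n - 1) < 2 * p by have := ltn_ord x; lia.
have [k jn] := nodes_cover ip xi; set j := _ %/ _ in jn.
have j0 := nodes_gt0 ip jn; have yn := hid_lt j0.
have yN : hid j < N by lia.
apply: (@connect_trans _ _ (Ordinal yN)); last by apply: tree => //; exists k;
  rewrite hidK.
apply: connect1; rewrite arcE mem_cat; apply/orP; right; apply/mem_int_arcs.
by exists (x - (2 * n - 1)), j; split=> //=; lia.
Qed.

Lemma mem_bpairs (x y : 'I_N) :
  [set x; y] \in pairs_of bs <-> exists i (c : bool),
    [/\ i < p, x = 2 * n - 1 + (2 * i + c) :> nat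
      & y = 2 * n - 1 + (2 * i + ~~ c) :> nat].
Proof.
split=> [/pairs_ofP|[i [c [ip xE yE]]]].
  rewrite bsE => -[] /mapP[i]; rewrite mem_iota => ip [e1 e2].
    by exists i, false; rewrite e1 e2; split=> //=; lia.
  by exists i, true; rewrite e1 e2; split=> //=; lia.
apply/pairs_ofP; rewrite bsE xE yE.
case: c {xE yE}; [right | left]; apply/mapP; exists i; rewrite ?mem_iota //=;
  by congr (_, _); lia.
Qed.

Lemma dag_model : dag_compression E G snk (pairs_of bs).
Proof.
split.
- move=> x y xy; apply/negP=> c.
  suff : dag_rank y <= dag_rank x by have := dag_rank_lt xy; lia.
  apply: (connect_back (P := fun z : 'I_N => dag_rank z <= dag_rank x) _ c) => // a b.
  by move/dag_rank_lt; lia.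
- split=> [u v [] /val_inj //|x].
  have -> : (x \in codom snk) = (x < n).
    apply/codomP/idP => [[v ->]|xn]; first exact: ltn_ord v.
    by exists (Ordinal xn); apply: val_inj.
  apply/forallP/idP => [h|xn y]; last first.
    rewrite arcE mem_cat; apply/negP=> /orP[/mem_tree_arcs[an bn b1 e]|/mem_int_arcs].
      by have := leq_hidx an; have := hidx_lt bn; lia.
    by move=> [i [j [_ e _ _]]]; lia.
  rewrite ltnNge; apply/negP=> nx.
  suff [y xy] : exists y, Defs.arc E x y by have := h y; rewrite xy.
  case: (ltnP x (2 * n - 1)) => xn.
    have hx := hidx_lt xn; have := leq_hidx xn => hn.
    have h2 : 0 < 2 * hidx x < 2 * n by lia.
    have yn := hid_lt h2.
    have yN : hid (2 * hidx x) < N by lia.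
    exists (Ordinal yN); rewrite arcE mem_cat; apply/orP; left.
    by apply/mem_tree_arcs; rewrite /= hidK //; split=> //; lia.
  have ip : x - (2 * n - 1) < 2 * p by have := ltn_ord x; lia.
  (* An empty interval would make its node a sink outside V(G). The first leaf [lo i] of the
     interval yields an outgoing arc. *)
  set i := _ - _ in ip; have [a b] := bounds ip; have lh := lt_lo_hi ip.
  have [|v ev] := @hidx_leaf_exists (lo i); first lia.
  have vi : in_int i v by rewrite /in_int ev; lia.
  have [k jn] := nodes_cover ip vi; set j := _ %/ _ in jn.
  have j0 := nodes_gt0 ip jn; have yn := hid_lt j0.
  have yN : hid j < N by lia.
  exists (Ordinal yN); rewrite arcE mem_cat; apply/orP; right.
  by apply/mem_int_arcs; exists i, j; split=> //=; lia.
- move=> e eB; have [x [y ee]] := pairs_of_set2 eB.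
  move: eB; rewrite ee => /mem_bpairs[i [c [ip xE yE]]].
  rewrite cards2 (_ : x != y) //; apply/eqP=> xy; move: xE; rewrite xy yE.
  by case: c {yE} => /=; lia.
move=> u v; rewrite adjE; split=> [[i [c [ip ui vi]]]|[x [y [xy xu yv]]]].
  have xN : 2 * n - 1 + (2 * i + c) < N by case: c {ui vi} => /=; lia.
  have yN : 2 * n - 1 + (2 * i + ~~ c) < N by case: c {ui vi xN} => /=; lia.
  exists (Ordinal xN), (Ordinal yN); split; first by apply/mem_bpairs; exists i, c.
    by apply/dag_reach; rewrite /dag_leaf /= ifF ?addKn //; lia.
  by apply/dag_reach; rewrite /dag_leaf /= ifF ?addKn //; lia.
have [i [c [ip xE yE]]] := (mem_bpairs _ _).1 xy.
exists i, c; split=> //.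
  by move/dag_reach: xu; rewrite /dag_leaf xE ifF ?addKn //; lia.
by move/dag_reach: yv; rewrite /dag_leaf yE ifF ?addKn //; lia.
Qed.

End Dag.

(** * The positive tree model *)

Section Tree.

Local Notation N := (2 * n - 1).
Local Notation edges := (tree_edges p).

Lemma mem_tree_edges a b : (a, b) \in edges <->
  exists i j j', [/\ i < p, j \in nodes (2 * i), j' \in nodes (2 * i).+1,
                    a = hid j & b = hid j'].
Proof.
split=> [/flatten_mapP[i]|[i [j [j' [ip jn jn' -> ->]]]]].
  rewrite mem_iota => ip /flatten_mapP[j jn] /mapP[j' jn' [-> ->]].
  by exists i, j, j'.
apply/flatten_mapP; exists i; first by rewrite mem_iota.
by apply/flatten_mapP; exists j => //; apply/mapP; exists j'.
Qed.

Lemma tree_edges_lt e : e \in edges -> e.1 < N /\ e.2 < N.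
Proof.
case: e => a b /mem_tree_edges[i [j [j' [ip jn jn' -> ->]]]] /=.
by split; apply: hid_lt => //; [apply: nodes_gt0 jn | apply: nodes_gt0 jn']; lia.
Qed.

(** [insub] rejects exactly the out-of-range value that [parn] gives to the root. *)
Definition tree_par (x : 'I_N) : option 'I_N := insub (parn x).

Lemma tree_par_list :
  [seq oapp val N (tree_par x) | x <- enum 'I_N] = [seq parn x | x <- iota 0 N].
Proof.
rewrite -val_enum_ord -map_comp; apply: eq_map => x /=.
rewrite /tree_par; case: insubP => [y _ <- //|]; rewrite -leqNgt /= => h.
apply/eqP; rewrite eqn_leq h /parn; have := hidx_lt (ltn_ord x).
by case: ifP; lia.
Qed.

Variables (bs : seq ('I_N * 'I_N)) (leN : n <= N).
Hypothesis bsE : map (@npair N) bs = edges.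

Local Notation par := tree_par.
Local Notation leaf := (widen_ord leN).
Local Notation anc := (ancestor par).
Local Notation B := (pairs_of bs).

Lemma parE (x y : 'I_N) : (par x == Some y) = (1 < hidx x) && (hidx x %/ 2 == hidx y).
Proof.
have x0 := hidx_lt (ltn_ord x); have y0 := hidx_lt (ltn_ord y).
rewrite /tree_par; case: insubP => [z zn|]; rewrite /parn /=.
  case: ifP => [h ez|h ez]; first by have := ltn_ord z; rewrite ez; lia.
  rewrite (_ : 1 < hidx x) /=; last lia.
  have q0 : 0 < hidx x %/ 2 by lia.
  have ez' : hidx z = hidx x %/ 2.
    by rewrite ez; move: (hidx x %/ 2) q0 => q q0; rewrite /hidx ifF; lia.
  rewrite -ez'; apply/eqP/eqP => [[->] //|e].
  by congr Some; apply/val_inj/hidx_inj => //; apply: ltn_ord.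
case: ifP => h; last by lia.
by move=> _; rewrite (_ : 1 < hidx x = false) //; lia.
Qed.

(** In a heap, the ancestors of a node are the prefixes of its binary expansion. *)
Lemma ancestorP (x y : 'I_N) : anc x y <-> exists k, hidx y %/ 2 ^ k = hidx x.
Proof.
split=> [c|[k]].
  apply: (connect_back (P := fun z : 'I_N => exists k, hidx z %/ 2 ^ k = hidx x) _ c).
    move=> a b; rewrite /= parE => /andP[_ /eqP e] [k <-].
    by exists k.+1; rewrite divn2X e.
  by exists 0; rewrite divn1.
elim: k y => [|k IH] y e.
  suff -> : x = y by exact: connect0.
  by apply/val_inj/hidx_inj; rewrite ?ltn_ord // -e divn1.
have x0 := hidx_lt (ltn_ord x); have y0 := hidx_lt (ltn_ord y).
rewrite divn2X in e.
have y1 : 0 < hidx y %/ 2.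
  by rewrite lt0n; apply/eqP=> q0; rewrite q0 div0n in e; lia.
have y2 : 0 < hidx y %/ 2 < 2 * n by lia.
have zn := hid_lt y2.
have zx := IH (Ordinal zn); rewrite /= hidK // in zx.
apply: (@connect_trans _ _ (Ordinal zn)); last exact: zx.
by apply: connect1; rewrite /= parE /= hidK // eqxx andbT; lia.
Qed.

Lemma strict_ancestor_irr (x y : 'I_N) :
  strict_ancestor par x y -> anc y x -> False.
Proof.
move=> /andP[xy /ancestorP[k e]] /ancestorP[k' e'].
move/negP: xy; apply; apply/eqP/val_inj/hidx_inj; rewrite ?ltn_ord //=.
have xy : hidx x <= hidx y by rewrite -e leq_div.
have yx : hidx y <= hidx x by rewrite -e' leq_div.
by apply/eqP; rewrite eqn_leq xy.
Qed.

Lemma ancestor_trans (x y z : 'I_N) : anc x y -> anc y z -> anc x z.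
Proof. by move=> xy yz; apply: connect_trans yz xy. Qed.

Lemma mem_treeB (x y : 'I_N) : [set x; y] \in B <-> exists i (c : bool),
  [/\ i < p, hidx x \in nodes (2 * i + c) & hidx y \in nodes (2 * i + ~~ c)].
Proof.
split=> [/pairs_ofP|[i [c [ip xn yn]]]].
  rewrite bsE => -[] /mem_tree_edges[i [j [j' [ip jn jn' e e']]]].
    exists i, false; rewrite e e' !hidK ?addn0 ?addn1 //; apply: nodes_gt0;
      try eassumption; lia.
  exists i, true; rewrite e e' !hidK ?addn0 ?addn1 //; apply: nodes_gt0;
    try eassumption; lia.
apply/pairs_ofP; rewrite bsE.
case: c xn yn; rewrite /= ?addn0 ?addn1 => xn yn; [right | left];
  apply/mem_tree_edges; [exists i, (hidx y), (hidx x) | exists i, (hidx x), (hidx y)];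
  by rewrite !hidxK ?ltn_ord.
Qed.

Lemma node_below (x : 'I_N) i (v : 'I_n) : i < 2 * p -> hidx x \in nodes i ->
  anc x (leaf v) -> in_int i v.
Proof. by move=> ip xn /ancestorP[k e]; apply: nodes_leaf ip xn e. Qed.

Lemma node_has_leaf (x : 'I_N) i : i < 2 * p -> hidx x \in nodes i ->
  exists v : 'I_n, anc x (leaf v).
Proof.
move=> ip /(nodes_has_leaf ip)[v [k [_ e]]]; exists v.
by apply/ancestorP; exists k.
Qed.

Lemma side_lt i (c : bool) : i < p -> 2 * i + c < 2 * p.
Proof. by case: c => /=; lia. Qed.

(** Otherwise a leaf below the lower end would lie on both sides of the biclique. This gives
    transversality and the degenerate cases of crossing. *)
Lemma edge_not_ancestor (x y : 'I_N) : [set x; y] \in B -> ~ anc x y.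
Proof.
move=> /mem_treeB[i [c [ip xn yn]]] xy.
have [v yv] := node_has_leaf (side_lt _ ip) yn.
apply: (@sides_disjoint i c v) => //; first exact: node_below (side_lt _ ip) xn
  (ancestor_trans xy yv).
exact: node_below (side_lt _ ip) yn yv.
Qed.

Lemma edge_distinct (x y : 'I_N) : [set x; y] \in B -> x != y.
Proof.
by move=> /edge_not_ancestor xy; apply/eqP=> e; apply: xy; rewrite e; apply: connect0.
Qed.

(* Leaves below [y] and [x'] give an edge of [G] in the bicliques of both
   pairs, hence these bicliques coincide; within one side the nodes form an
   antichain. *)
Lemma edges_not_crossing (x x' y y' : 'I_N) :
  [set x; x'] \in B -> [set y; y'] \in B ->
  strict_ancestor par x y -> strict_ancestor par y' x' -> False.
Proof.
move=> /mem_treeB[i [c [ip xn xn']]] /mem_treeB[j [d [jp yn yn']]] xy yx'.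
have [/andP[xNy ay] /andP[_ ay']] := (xy, yx').
have [u yu] := node_has_leaf (side_lt _ jp) yn.
have [v xv] := node_has_leaf (side_lt _ ip) xn'.
have xu := node_below (side_lt _ ip) xn (ancestor_trans ay yu).
have yv := node_below (side_lt _ jp) yn' (ancestor_trans ay' xv).
have {}yu := node_below (side_lt _ jp) yn yu.
have {}xv := node_below (side_lt _ ip) xn' xv.
have e := bicliques_disjoint ip jp xu xv yu yv; rewrite -{j jp}e in yn yn' yu yv.
have e : d = c.
  case: (eqVneq d c) => // dc; have e : d = ~~ c by case: (d) (c) dc => [] [].
  by rewrite e in yu; case: (sides_disjoint ip xu yu).
rewrite e in yn; move/ancestorP: ay => [k kE].
have [a b] := bounds (side_lt c ip).
have := qnodes_antichain a b n0 xn yn kE => h.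
by move/eqP: xNy; apply; apply/val_inj/hidx_inj; rewrite ?ltn_ord.
Qed.

Lemma halving_to_1 h : 0 < h -> exists k, h %/ 2 ^ k = 1.
Proof.
elim/ltn_ind: h => h IH h0; case: (ltnP h 2) => h2.
  by exists 0; rewrite divn1; lia.
by have [||k e] := IH (h %/ 2); try lia; exists k.+1; rewrite divn2X.
Qed.

(** The largest heap number [2 * n - 1] is odd, so [2 * h] and [2 * h + 1] are both present or both
    absent; the tree is full for every [n]. *)
Lemma tree_children (x : 'I_N) :
  if n <= hidx x then children par x = set0 else #|children par x| = 2.
Proof.
have x0 := hidx_lt (ltn_ord x).
case: ifP => xn.
  apply/setP=> y; rewrite !inE parE; have := hidx_lt (ltn_ord y).
  by move=> y0; apply/negP=> /andP[_ /eqP]; lia.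
have h0 : 0 < 2 * hidx x < 2 * n by lia.
have h1 : 0 < (2 * hidx x).+1 < 2 * n by lia.
have y0 := hid_lt h0; have y1 := hid_lt h1.
have -> : children par x = [set Ordinal y0; Ordinal y1].
  apply/setP=> y; rewrite !inE parE.
  apply/andP/orP => [[y2 /eqP e]|[] /eqP->]; last first.
  - by rewrite /= hidK //; split; lia.
  - by rewrite /= hidK //; split; lia.
  case: (boolP (odd (hidx y))) => o; [right | left]; apply/eqP/val_inj/hidx_inj => //=;
    by rewrite hidK //; lia.
rewrite cards2 (_ : Ordinal y0 != Ordinal y1) //; apply/eqP=> -[] e.
have := congr1 hidx e; rewrite !hidK //; lia.
Qed.

Lemma tree_leafE (x : 'I_N) : is_leaf par x = (n <= hidx x).
Proof.
by rewrite /is_leaf; have := tree_children x; case: ifP => _ ->; rewrite ?cards0.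
Qed.

Lemma tree_model : positive_tree_model par G leaf B.
Proof.
split.
- split=> [|x]; last first.
    rewrite tree_leafE; have := tree_children x.
    by case: ifP => _ h; [left | right].
  have h1 : 0 < 1 < 2 * n by lia.
  have rn := hid_lt h1; exists (Ordinal rn); split=> [|x].
    by rewrite /tree_par insubF // /parn /= hidK // ltnn.
  apply/ancestorP; rewrite /= hidK //; apply: halving_to_1.
  by have := hidx_lt (ltn_ord x); lia.
- split=> [u v [] /val_inj //|x]; rewrite tree_leafE leq_hidx ?ltn_ord //.
  apply/idP/codomP => [xn|[v ->]]; last exact: ltn_ord v.
  by exists (Ordinal xn); apply: val_inj.
- move=> e eB; have [x [y ee]] := pairs_of_set2 eB; rewrite ee in eB *.
  split; first by rewrite cards2 edge_distinct.
  have eB' : [set y; x] \in B by rewrite setUC.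
  move=> a b; rewrite !inE => /orP[] /eqP-> /orP[] /eqP->; apply/negP=> /andP[ne an];
    by [rewrite eqxx in ne | case: (edge_not_ancestor eB) | case:
      (edge_not_ancestor eB')].
- move=> e f eB fB _; apply/negP.
  have [x1 [x2 ee]] := pairs_of_set2 eB; have [y1 [y2 ef]] := pairs_of_set2 fB.
  move=> /andP[/exists_inP[x xe /exists_inP[y yf xy]]].
  move=> /exists_inP[y' yf' /exists_inP[x' xe' yx']].
  have pair (T : finType) (a1 a2 a b : T) : a \in [set a1; a2] -> b \in [set a1; a2] ->
      a != b -> [set a1; a2] = [set a; b].
    by rewrite !inE => /orP[] /eqP-> /orP[] /eqP->; rewrite ?eqxx // setUC.
  have [/andP[_ axy] /andP[_ ayx]] := (xy, yx').
  rewrite ee in eB xe xe'; rewrite ef in fB yf yf'.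
  (* The witnesses of the two ancestries may coincide within a pair. If they do so in both pairs,
     strict ancestry holds in both directions; if in just one, the ends of the other pair are
     comparable. The remaining case is [edges_not_crossing]. *)
  case: (eqVneq x x') => [exx|nx].
    rewrite -exx in ayx yx'; case: (eqVneq y' y) => [eyy|ny].
      by rewrite eyy in ayx; apply: strict_ancestor_irr xy ayx.
    rewrite (pair _ _ _ _ _ yf' yf ny) in fB.
    exact: edge_not_ancestor fB (ancestor_trans ayx axy).
  case: (eqVneq y y') => [eyy|ny].
    rewrite -eyy in ayx; rewrite (pair _ _ _ _ _ xe xe' nx) in eB.
    exact: edge_not_ancestor eB (ancestor_trans axy ayx).
  rewrite (pair _ _ _ _ _ xe xe' nx) in eB; rewrite (pair _ _ _ _ _ yf yf' ny) in fB.
  exact: edges_not_crossing eB fB xy yx'.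
move=> u v; rewrite adjE; split=> [[i [c [ip ui vi]]]|[x [y [xy xu yv]]]].
  have node (d : bool) w : in_int (2 * i + d) w ->
      exists2 x : 'I_N, hidx x \in nodes (2 * i + d) & anc x (leaf w).
    move=> wi; have [k jn] := nodes_cover (side_lt d ip) wi.
    have j0 := nodes_gt0 (side_lt d ip) jn; have xn := hid_lt j0.
    exists (Ordinal xn); first by rewrite /= hidK.
    by apply/ancestorP; exists k; rewrite /= hidK.
  have [[x xn xu] [y yn yv]] := (node _ _ ui, node _ _ vi).
  by exists x, y; split=> //; apply/mem_treeB; exists i, c.
have [i [c [ip xn yn]]] := (mem_treeB _ _).1 xy.
by exists i, c; split=> //; [apply: node_below xn xu | apply: node_below yn yv];
  rewrite ?side_lt.
Qed.

End Tree.

End Layout.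

(** * The encoded input *)

Lemma nth_flatten4 (T : Type) (x0 : T) (f : T -> seq nat) s i k :
  (forall x, size (f x) = 4) -> i < size s -> k < 4 ->
  nth 0 (flatten [seq f x | x <- s]) (4 * i + k) = nth 0 (f (nth x0 s i)) k.
Proof.
move=> f4 + k4; elim: s i => // x s IH [|i] /= lt.
  by rewrite nth_cat f4 muln0 k4.
by rewrite nth_cat f4 ifF -?IH //; [congr nth; lia | lia].
Qed.

Section Encoding.

Variables (n : nat) (G le : rel 'I_n) (qs : seq (interval_pair 'I_n)).
Hypothesis n0 : 0 < n.
Hypothesis sg : simple_graph G.
Hypothesis ibp : interval_biclique_partition G le qs.

Local Notation p := (size qs).

Definition order_list := [seq val v | v <- sort le (enum 'I_n)].
Definition order_nth := nth 0 order_list.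
Definition order_index x := index x order_list.
Definition inp_word := nth 0 (encode_ibp le qs).

Lemma size_order_list : size order_list = n.
Proof. by rewrite size_map size_sort size_enum_ord. Qed.

Lemma order_list_uniq : uniq order_list.
Proof. by rewrite (map_inj_uniq val_inj) sort_uniq enum_uniq. Qed.

Lemma mem_order_list x : (x \in order_list) = (x < n).
Proof.
apply/mapP/idP => [[v _ ->]|xn]; first exact: ltn_ord.
by exists (Ordinal xn); rewrite // mem_sort mem_enum.
Qed.

Lemma order_nth_lt i : i < n -> order_nth i < n.
Proof. by move=> lt; rewrite -mem_order_list mem_nth // size_order_list. Qed.

Lemma order_index_lt x : x < n -> order_index x < n.
Proof. by rewrite -mem_order_list -index_mem size_order_list. Qed.

Lemma order_nthK i : i < n -> order_index (order_nth i) = i.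
Proof. by move=> lt; apply: index_uniq; rewrite ?size_order_list ?order_list_uniq. Qed.

Lemma order_indexK x : x < n -> order_nth (order_index x) = x.
Proof. by move=> lt; apply: nth_index; rewrite mem_order_list. Qed.

Lemma inp_word0 : inp_word 0 = n. Proof. by []. Qed.

Lemma inp_word1 : inp_word 1 = p. Proof. by []. Qed.

Lemma inp_wordO i : i < n -> inp_word (i + 2) = order_nth i.
Proof.
by move=> lt; rewrite addnC /inp_word /encode_ibp /= nth_cat size_order_list lt.
Qed.

Definition side (c : bool) (q : interval_pair 'I_n) := if c then q.2 else q.1.

(** The endpoints follow two header words and [n] vertices; [c] selects the side and [d] the end. *)
Lemma inp_word_side q0 i (c d : bool) : i < p ->
  inp_word (n + 2 + (2 * (2 * i + c) + d)) =
  if d then (side c (nth q0 qs i)).2 else (side c (nth q0 qs i)).1.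
Proof.
move=> ip; rewrite addnAC addnC [n + _]addnC /inp_word /encode_ibp /=.
rewrite -/order_list addnC nth_cat size_order_list ifF; last lia.
rewrite (_ : _ - n = 4 * i + (2 * c + d)); last lia.
rewrite (nth_flatten4 q0) //; last by case: c; case: d.
by case: c; case: d.
Qed.

Lemma inp_word_ends q0 i (c : bool) : i < p ->
  inp_word (n + 2 + 2 * (2 * i + c)) = (side c (nth q0 qs i)).1 /\
  inp_word (n + 2 + (2 * (2 * i + c)).+1) = (side c (nth q0 qs i)).2.
Proof.
move=> ip; have := inp_word_side q0 c true ip; have := inp_word_side q0 c false ip.
by rewrite /= addn0 addn1.
Qed.

Lemma le_order_index u v : le u v = (order_index u <= order_index v).
Proof.
have [[le_refl le_anti le_trans le_total] _ _ _] := ibp.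
have idx (w : 'I_n) : order_index w = index w (sort le (enum 'I_n)).
  by rewrite /order_index index_map //; apply: val_inj.
have mem (w : 'I_n) : w \in sort le (enum 'I_n) by rewrite mem_sort mem_enum.
have srt := sort_sorted le_total (enum 'I_n).
have imp (x y : 'I_n) : order_index x <= order_index y -> le x y.
  by rewrite !idx => h; apply: (sorted_leq_index le_trans le_refl srt).
apply/idP/idP => [uv|]; last exact: imp.
case: (leqP (order_index u) (order_index v)) => // vu.
have e : u = v by apply: le_anti; rewrite uv imp // ltnW.
by rewrite e ltnn in vu.
Qed.

Local Notation in_side := (@in_int n inp_word order_index).

Lemma in_intE q0 i (c : bool) v : i < p ->
  in_side (2 * i + c) v = (v \in interval le (side c (nth q0 qs i))).
Proof.
move=> ip; rewrite inE !le_order_index /in_int /lo /hi /ep /hidx ltn_ord.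
by have [-> ->] := inp_word_ends q0 c ip; rewrite addn1 ltnS !leq_add2r.
Qed.

Lemma interval_nonempty q0 i (c : bool) : i < p ->
  le (side c (nth q0 qs i)).1 (side c (nth q0 qs i)).2.
Proof.
have [_ qsP _ _] := ibp.
by move=> ip; have [] := qsP _ (mem_nth q0 ip); case: c.
Qed.

Let q0 : interval_pair 'I_n :=
  ((Ordinal n0, Ordinal n0), (Ordinal n0, Ordinal n0)).

Lemma side_index i : exists k (c : bool), i = 2 * k + c.
Proof. by exists i./2, (odd i); lia. Qed.

Lemma inp_wordE i : i < 4 * p -> inp_word (n + 2 + i) < n.
Proof.
move=> ip; have [m [d e]] := side_index i; have [k [c e']] := side_index m.
rewrite e e' (inp_word_side q0); last lia.
by case: d {e}; apply: ltn_ord.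
Qed.

Lemma lo_lt_hi i : i < 2 * p ->
  lo n inp_word order_index i < hi n inp_word order_index i.
Proof.
move=> ip; have [k [c e]] := side_index i.
have kp : k < p by lia.
have := interval_nonempty q0 c kp; rewrite le_order_index.
rewrite e /lo /hi /ep.
by have [-> ->] := inp_word_ends q0 c kp; lia.
Qed.

Lemma mem_biclique q u v :
  [set u; v] \in biclique le q <->
  exists c, u \in interval le (side c q) /\ v \in interval le (side (~~ c) q).
Proof.
split=> [/imset2P[a b aX bY /set2_eq[[-> ->]|[-> ->]]]|[[] [uX vY]]].
- by exists false.
- by exists true.
- by rewrite setUC; apply: imset2_f.
- exact: imset2_f.
Qed.

Lemma adj_biclique u v :
  G u v <-> exists2 i, i < p & [set u; v] \in biclique le (nth q0 qs i).
Proof.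
have [Gsym _] := sg; have [_ _ _ /cover_partition cov] := ibp.
have -> : G u v <-> [set u; v] \in edges G.
  split=> [uv|/imsetP[[a b] ab /set2_eq]]; first by apply/imsetP; exists (u, v);
    rewrite ?inE.
  by rewrite inE /= in ab; case=> -[-> ->] //; rewrite Gsym.
rewrite -cov; split=> [/bigcupP[b]|[i ip h]].
  rewrite inE => /mapP[q /(nthP q0)[i ip <-] ->] h; by exists i.
apply/bigcupP; exists (biclique le (nth q0 qs i)) => //.
by rewrite inE map_f ?mem_nth.
Qed.

Lemma adj_in_int u v : G u v <-> exists i (c : bool),
  [/\ i < p, in_side (2 * i + c) u & in_side (2 * i + ~~ c) v].
Proof.
rewrite adj_biclique; split=> [[i ip /mem_biclique[c [h1 h2]]]|[i [c [ip]]]].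
  by exists i, c; rewrite !(in_intE q0).
by rewrite !(in_intE q0) // => h1 h2; exists i => //; apply/mem_biclique; exists c.
Qed.

Lemma in_int_sides i (c : bool) v : i < p ->
  in_side (2 * i + c) v -> in_side (2 * i + ~~ c) v -> False.
Proof.
have [_ qsP _ _] := ibp.
move=> ip; rewrite !(in_intE q0) //; have [_ _ dis] := qsP _ (mem_nth q0 ip).
by case: c => h1 h2; have := disjointFr dis; [move/(_ _ h2) | move/(_ _ h1)];
  rewrite ?h1 ?h2.
Qed.

(** Two parts that share the edge [uv] are equal, and [uniq] turns equal parts into equal
    indices. *)
Lemma in_int_bicliques i j (c d : bool) u v : i < p -> j < p ->
  in_side (2 * i + c) u -> in_side (2 * i + ~~ c) v ->
  in_side (2 * j + d) u -> in_side (2 * j + ~~ d) v -> i = j.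
Proof.
have [_ _ uq /and3P[_ triv _]] := ibp.
move=> ip jp; rewrite !(in_intE q0) // => h1 h2 h3 h4.
have bi : [set u; v] \in biclique le (nth q0 qs i) by apply/mem_biclique; exists c.
have bj : [set u; v] \in biclique le (nth q0 qs j) by apply/mem_biclique; exists d.
have mb k : k < p -> biclique le (nth q0 qs k) \in
    [set b in [seq biclique le q | q <- qs]].
  by move=> kp; rewrite inE map_f ?mem_nth.
have := def_pblock triv (mb i ip) bi; rewrite (def_pblock triv (mb j jp) bj) => e.
apply/eqP; rewrite -(nth_uniq (biclique le q0) _ _ uq) ?size_map //.
by rewrite !(nth_map q0) // e.
Qed.

(** A biclique has two disjoint nonempty sides, which a single vertex cannot provide. Hence [p] is
    at most [p * log n], which absorbs the additive constant in [F]. *)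
Lemma log_gt0 : 0 < p -> 0 < trunc_log 2 n.
Proof.
move=> p0; rewrite trunc_log_gt0 /= ltnNge; apply/negP=> n1.
have [[le_refl _ _ _] _ _ _] := ibp.
have ne c : Ordinal n0 \in interval le (side c (nth q0 qs 0)).
  have all0 (w : 'I_n) : w = Ordinal n0 by apply: val_inj => /=; have := ltn_ord w; lia.
  by rewrite inE (all0 (side _ _).1) (all0 (side _ _).2) le_refl.
by apply: (@in_int_sides 0 false (Ordinal n0) p0); rewrite (in_intE q0).
Qed.

Lemma leq_size_log : p <= p * trunc_log 2 n.
Proof. by case: (posnP p) => [->|/log_gt0]; last exact: leq_pmulr. Qed.

End Encoding.

(** * Numerical bounds and the final statements *)

Lemma leq_double_exp_log n : 0 < n -> 2 * n <= 2 ^ (trunc_log 2 n + 2).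
Proof.
by move=> n0; have := trunc_log_ltn n (isT : 1 < 2); rewrite addn2 !expnS; lia.
Qed.

Lemma log_lt n : 0 < n -> trunc_log 2 n < n.
Proof. by move=> n0; apply: leq_trans (trunc_logP (isT : 1 < 2) n0);
  apply: ltn_expl. Qed.

(** This fixes the exponent 8: addresses are at most cubic in [M = n + p + 2], and since [M >= 2]
    the remaining factor [M ^ 5] is at least 32, which exceeds the total coefficient 8 + 14. *)
Lemma word_bound_ge n p L : L <= 8 * (n + p + 2) ^ 3 ->
  14 * p + 12 * n + 20 + L < word_bound 8 n p.
Proof.
rewrite /word_bound (expnD _ 5 3); set M := n + p + 2 => LM.
have h5 : 2 ^ 5 <= M ^ 5 by rewrite leq_exp2r // /M addn2.
have h3 : M <= M ^ 3 by rewrite -{1}[M]expn1 leq_exp2l // /M addn2.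
have : 32 * M ^ 3 <= M ^ 5 * M ^ 3 by rewrite leq_mul2r h5 orbT.
by move: LM h3; rewrite /M; lia.
Qed.

Lemma dag_prog_correct (n : nat) (G le : rel 'I_n) (qs : seq (interval_pair 'I_n)) :
  0 < n -> simple_graph G -> interval_biclique_partition G le qs ->
  let p := size qs in
  exists (t : nat) (s : state) (N : nat) (leN : n <= N)
         (E : {set 'I_N * 'I_N}) (B : {set {set 'I_N}}),
    [/\ run (word_bound 8 n p) dag_prog (initial_state (encode_ibp le qs)) t s,
        outputs_dag s E B,
        dag_compression E G (widen_ord leN) B,
        dag_size E B <= 1000 * (n + p * trunc_log 2 n)
      & t <= 1000 * (n + p * trunc_log 2 n)].
Proof.
move=> n0 sg ibp p.
have logp := leq_size_log n0 ibp; rewrite -/p in logp.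
have nF := leq_double_exp_log n0; have Fn := log_lt n0.
(* One unit makes up for the truncation of the logarithm, the other for range bounds that reach
   [2 * n]. *)
set F := trunc_log 2 n + 2 in nF.
have hW : body_addr n p 3 + 10 * n + 10 * p + 8 * (p * F) + 10 < word_bound 8 n p.
  rewrite /body_addr /out_addr /pos_addr.
  have := @word_bound_ge n p (8 * (p * F)).
  suff : p * F <= (n + p + 2) ^ 3 by lia.
  by rewrite (leq_trans (leq_pmulr _ (_ : 0 < n + p + 2))) ?addn2 //
    !expnS expn0 muln1 mulnA leq_mul // leq_mul; lia.
have [o_lt x_lt] := (@order_nth_lt n le, @order_index_lt n le).
have [oK xK] := (@order_nthK n le, @order_indexK n le).
have inE' := @inp_wordE n le qs n0.
have [t [s [r tle out]]] := dag_prog_spec n0 o_lt x_lt inE' nF oK xK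
  (inp_word0 le qs) (inp_word1 le qs) (@inp_wordO n le qs) hW erefl (leqnn _)
  (s := initial_state (encode_ibp le qs)) (fun a => erefl).
have [es esE] := npair_lift (dag_arcs_lt n0 o_lt x_lt inE' nF oK xK).
have [bs bsE] := npair_lift (bpairs_lt n0 nF (p := p)).
have leN : n <= 2 * n - 1 + 2 * p by lia.
exists t, s, (2 * n - 1 + 2 * p), leN, [set e in es], (pairs_of bs).
have sbs : size bs = p by rewrite -(size_map (@npair _)) bsE size_map size_iota.
have ses : size es = size (dag_arcs n p F (inp_word le qs) (order_nth le)
  (order_index le)).
  by rewrite -esE size_map.
have ses' : size es <= 2 * n + 4 * (p * F).
  rewrite ses size_cat size_tree_arcs.
  by have := size_int_arcs n F (inp_word le qs) (order_nth le) (order_index le) (2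
    * p); lia.
split=> //.
- by exists es, bs; rewrite !flatten_npair esE bsE ses sbs.
- exact: (dag_model n0 o_lt x_lt inE' nF oK xK (lo_lt_hi n0 ibp) (adj_in_int n0 sg ibp)
    leN esE bsE).
- have cE : #|[set e in es]| <= size es by rewrite cardsE card_size.
  apply: leq_trans (leq_add (leq_add (leqnn _) cE) (card_pairs_of bs)) _.
  by move: ses'; rewrite card_ord sbs /F; lia.
by move: tle; rewrite -/p /F; lia.
Qed.

Lemma tree_prog_correct (n : nat) (G le : rel 'I_n) (qs : seq (interval_pair 'I_n)) :
  0 < n -> simple_graph G -> interval_biclique_partition G le qs ->
  let p := size qs in
  exists (t : nat) (s : state) (N : nat) (leN : n <= N)
         (par : 'I_N -> option 'I_N) (B : {set {set 'I_N}}),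
    [/\ run (word_bound 8 n p) tree_prog (initial_state (encode_ibp le qs)) t s,
        outputs_tree s par B,
        positive_tree_model par G (widen_ord leN) B,
        #|B| <= 2000 * (p * trunc_log 2 n ^ 2)
      & t <= 2000 * (n + p * trunc_log 2 n ^ 2)].
Proof.
move=> n0 sg ibp p.
have logp := leq_size_log n0 ibp; rewrite -/p in logp.
(* Expanding [p * (log n + 2) ^ 2] leaves terms in [p * log n] and [p], which [logp2] and [logp]
   absorb. *)
have logp2 : p * trunc_log 2 n <= p * trunc_log 2 n ^ 2.
  by rewrite mulnA leq_mul2r logp orbT.
have nF := leq_double_exp_log n0; have Fn := log_lt n0.
set F := trunc_log 2 n + 2 in nF.
have hW : body_addr n p 2 + 10 * n + 10 * p + p * (2 * F * (2 * F)) * 2 + 10 <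
          word_bound 8 n p.
  rewrite /body_addr /out_addr /pos_addr.
  have := @word_bound_ge n p (p * (2 * F * (2 * F)) * 2).
  suff : p * (F * F) <= (n + p + 2) ^ 3 by lia.
  by rewrite !expnS expn0 muln1 leq_mul // ?leq_mul //; lia.
have [o_lt x_lt] := (@order_nth_lt n le, @order_index_lt n le).
have [oK xK] := (@order_nthK n le, @order_indexK n le).
have inE' := @inp_wordE n le qs n0.
have [t [s [r tle out]]] := tree_prog_spec n0 o_lt x_lt inE' nF oK xK
  (inp_word0 le qs) (inp_word1 le qs) (@inp_wordO n le qs) hW erefl (leqnn _)
  (s := initial_state (encode_ibp le qs)) (fun a => erefl).
have [bs bsE] := npair_lift (tree_edges_lt n0 o_lt x_lt inE' nF).
have leN : n <= 2 * n - 1 by lia.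
exists t, s, (2 * n - 1), leN, (@tree_par n (order_index le)), (pairs_of bs).
have sbs : size bs = size (tree_edges n F (inp_word le qs) (order_nth le)
  (order_index le) p).
  by rewrite -bsE size_map.
split=> //.
- exists bs; split=> //.
  by rewrite (tree_par_list n0 x_lt nF) flatten_npair bsE sbs.
- exact: (tree_model n0 o_lt x_lt inE' nF oK xK (adj_in_int n0 sg ibp)
    (in_int_sides n0 ibp) (in_int_bicliques n0 ibp) leN bsE).
- have := card_pairs_of bs.
  have := size_tree_edges n F (inp_word le qs) (order_nth le) (order_index le) p.
  by rewrite sbs /F; lia.
by move: tle; rewrite -/p /F; lia.
Qed.

Theorem lemma3p4 :
  (exists (prog : com) (k C : nat),
    forall (n : nat) (G : rel 'I_n) (le : rel 'I_n)
           (qs : seq (interval_pair 'I_n)),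
      0 < n -> simple_graph G -> interval_biclique_partition G le qs ->
      let p := size qs in
      exists (t : nat) (s : state) (N : nat) (leN : n <= N)
             (E : {set 'I_N * 'I_N}) (B : {set {set 'I_N}}),
        [/\ run (word_bound k n p) prog (initial_state (encode_ibp le qs)) t s,
            outputs_dag s E B,
            dag_compression E G (widen_ord leN) B,
            dag_size E B <= C * (n + p * trunc_log 2 n)
          & t <= C * (n + p * trunc_log 2 n)])
  /\
  (exists (prog : com) (k C : nat),
    forall (n : nat) (G : rel 'I_n) (le : rel 'I_n)
           (qs : seq (interval_pair 'I_n)),
      0 < n -> simple_graph G -> interval_biclique_partition G le qs ->
      let p := size qs in
      exists (t : nat) (s : state) (N : nat) (leN : n <= N)
             (par : 'I_N -> option 'I_N) (B : {set {set 'I_N}}),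
        [/\ run (word_bound k n p) prog (initial_state (encode_ibp le qs)) t s,
            outputs_tree s par B,
            positive_tree_model par G (widen_ord leN) B,
            #|B| <= C * (p * trunc_log 2 n ^ 2)
          & t <= C * (n + p * trunc_log 2 n ^ 2)]).
Proof.
split.
- by exists dag_prog, 8, 1000; apply: dag_prog_correct.
- by exists tree_prog, 8, 2000; apply: tree_prog_correct.
Qed.
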